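(* Let $K$ be a number field of odd degree which is Galois over $\mathbb{Q}$, and assume that $K$ is either totally real or CM. Let $\mathrm{Mod}(K)$ denote the set of square-free positive integers $\ell$ such that there exists an Arakelov-modular lattice of level $\ell$ over $K$. Then $\mathrm{Mod}(K)=\{1\}$.
   Context: Let $\mathcal{O}_K$ be the ring of integers of $K$ and $\mathcal{D}_K$ the different of $K/\mathbb{Q}$. The bar denotes complex conjugation on $K$, which is the identity map when $K$ is totally real. An element $\alpha\in K^\times$ is totally positive if $\sigma(\alpha)$ is real and $>0$ for every $\sigma\in\mathrm{Gal}(K/\mathbb{Q})$ (with $K\subset\mathbb{C}$). An ideal lattice over $K$ is a pair $(I,\alpha)$, where $I$ is a (nonzero) fractional $\mathcal{O}_K$-ideal, $\alpha\in K^\times$ is totally positive, and $I$ carries the positive definite symmetric bilinear form $b_\alpha(x,y)=\mathrm{Tr}_{K/\mathbb{Q}}(\alpha x\bar{y})$. Its dual is $(I^*,\alpha)$ with $I^*=\alpha^{-1}\mathcal{D}_K^{-1}\bar{I}^{-1}=\{x\in K: b_\alpha(x,y)\in\mathbb{Z}\ \forall y\in I\}$. For a positive integer $\ell$, $(I,\alpha)$ is Arakelov-modular of level $\ell$ if there exists $\beta\in K^\times$ such that $I=\beta I^*$ and $\ell=\beta\bar{\beta}$. *)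

(* Defs.v *)
From HB Require Import structures.
From mathcomp Require Import all_boot all_order all_algebra all_fingroup all_field.
From mathcomp Require Import classical_sets.

Set Implicit Arguments.
Unset Strict Implicit.
Unset Printing Implicit Defensive.

Import Order.TTheory GRing.Theory Num.Theory.
Local Open Scope ring_scope.
Local Open Scope classical_set_scope.

(* Every embedding of a number field into the complex numbers has its image in
   the field algC of algebraic numbers, so algC plays the role of C. *)

Definition totally_real (L : fieldExtType rat) : Prop :=
  forall (f : {rmorphism L -> algC}) (x : L), f x \is Num.real.

Definition totally_imaginary (L : fieldExtType rat) : Prop :=
  forall f : {rmorphism L -> algC}, exists x : L, f x \isn't Num.real.

Definition CM_field (L : fieldExtType rat) : Prop :=
  totally_imaginary L /\
  exists F : {subfield L},
    \dim_F {:L} = 2%N /\ totally_real (subvs_of F).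

Definition squarefree (l : nat) : Prop :=
  forall d : nat, (d ^ 2 %| l)%N -> d = 1%N.

Definition ring_of_integers (K : fieldExtType rat) : set K :=
  [set x : K | integralOver (intr : int -> K) x].

Definition fractional_ideal (K : fieldExtType rat) (I : set K) : Prop :=
  [/\ I 0 /\ (forall x y, I x -> I y -> I (x + y)),
      forall a x, ring_of_integers a -> I x -> I (a * x),
      exists2 x, I x & x != 0
    & exists2 d, ring_of_integers d /\ d != 0 &
        forall x, I x -> ring_of_integers (d * x)].

(* The inclusion of K into the complex numbers is a parameter iota; as K is
   normal over Q, complex conjugation on C restricts to K. *)
Definition cconj (K : splittingFieldType rat) (iota : {rmorphism K -> algC}) :
    {lrmorphism K -> K} :=
  sval (restrict_aut_to_normal_num_field iota Num.conj).

Lemma cconjP (K : splittingFieldType rat) (iota : {rmorphism K -> algC}) :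
  forall x : K, iota (cconj iota x) = Num.conj (iota x).
Proof. by move=> x; rewrite /cconj; case: restrict_aut_to_normal_num_field. Qed.

(* In algC, 0 < z means that z is real and positive. *)
Definition totally_positive (K : splittingFieldType rat)
    (iota : {rmorphism K -> algC}) (alpha : K) : Prop :=
  forall s : gal_of {:K}, s \in 'Gal({:K} / 1)%g -> 0 < iota (s alpha).

Definition ideal_lattice (K : splittingFieldType rat)
    (iota : {rmorphism K -> algC}) (I : set K) (alpha : K) : Prop :=
  [/\ fractional_ideal I, alpha != 0 & totally_positive iota alpha].

Definition lattice_form (K : splittingFieldType rat)
    (iota : {rmorphism K -> algC}) (alpha x y : K) : K :=
  galTrace 1 {:K} (alpha * x * cconj iota y).

Definition dual_lattice (K : splittingFieldType rat)
    (iota : {rmorphism K -> algC}) (I : set K) (alpha : K) : set K :=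
  [set x : K | forall y, I y ->
     exists n : int, lattice_form iota alpha x y = n%:~R].

Definition arakelov_modular (K : splittingFieldType rat)
    (iota : {rmorphism K -> algC}) (l : nat) (I : set K) (alpha : K) : Prop :=
  exists beta : K,
    [/\ beta != 0,
        I = [set beta * x | x in dual_lattice iota I alpha]
      & l%:R = beta * cconj iota beta].

Definition Mod_set (K : splittingFieldType rat)
    (iota : {rmorphism K -> algC}) : set nat :=
  [set l : nat | [/\ (0 < l)%N, squarefree l &
     exists (I : set K) (alpha : K),
       ideal_lattice iota I alpha /\ arakelov_modular iota l I alpha]].

(* Main.v *)
Require Import Defs.
From HB Require Import structures.
From mathcomp Require Import all_boot all_order all_algebra all_fingroup all_field.
From mathcomp Require Import boolp classical_sets.
From mathcomp Require Import zify ring.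

Set Implicit Arguments.
Unset Strict Implicit.
Unset Printing Implicit Defensive.

Import Order.TTheory GRing.Theory Num.Theory.
Local Open Scope ring_scope.

(** A field of odd degree has no subfield over which it is quadratic, so K is
    not CM ([CM_field_even]); it is totally real and complex conjugation is the
    identity on it.  A level l is then a square beta^2 in K, and in a Galois
    extension of odd degree an element with a rational square is rational
    ([odd_sqrt_rat]): l is the square of a rational number, and a square-free
    square is 1.

    It remains to produce, with alpha = 1, an ideal I which is its own dual for
    the trace form, that is, a square root of the inverse different.  The
    existence of such a root says that the different has even exponent at each
    prime.  This is usually read off Hilbert's formula for the exponent in terms
    of the ramification groups; here it comes from the parity of the valuation
    of the discriminant.

    Fix a prime p and let B be the ring of elements of K integral at p.  It has
    finitely many maximal ideals, permuted transitively by the Galois group, so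
    a nonzero ideal of B stable under that group is a power of the Jacobson
    radical.
    The proof gets this without naming the maximal ideals: a stable ideal which
    is not inside the radical is all of B ([stable_ideal_full], by looking at
    norms), and the radical has a generator pi ([uniformizer_exists], a patching
    of idempotents in the finite ring B/p), whence [stable_ideal_power].

    Let n be the degree and v the p-adic valuation.  As pB = pi^e B, taking
    norms gives n = e v(N pi), and v(N pi) is odd ([uniformizer_odd]).  The
    dual of B for the trace form is also stable, hence equal to mu B
    with mu = pi^i / p^(2k).  The form Tr(mu x y) is then unimodular on B
    ([codiff_unimodular]), which says that N(mu) disc(B) is a unit at p.  But
    disc(B) is the square of a determinant with a rational square, and this
    determinant is rational by [odd_sqrt_rat] ([det_gram_square]).  So
    i v(N pi) is even, i is even, and mu = lambda^2 ([codiff_even_power]).  The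
    lattice lambda B is then self-dual at p ([local_selfdual]).

    Away from the discriminant of a basis of integers lambda can be taken equal
    to 1 ([codiff_unramified]), so the intersection over all p of the lattices
    lambda B is a fractional ideal, and it is self-dual
    ([unimodular_ideal_exists]). *)

(** * Rational numbers integral at a prime *)

Section PAdicRational.
Variable p : nat.
Hypothesis p_pr : prime p.

(** Membership in the localization of the integers at p.  The witness form, an
    integer prime to p clearing the denominator, makes closure under the ring
    operations immediate; [pint_val] gives the description by valuations. *)
Definition pint (q : rat) : Prop :=
  exists2 s : nat, ~~ (p %| s)%N & exists m : int, s%:R * q = m%:~R.

Lemma ndvdp_mul s t : ~~ (p %| s)%N -> ~~ (p %| t)%N -> ~~ (p %| s * t)%N.
Proof. by move=> ps pt; rewrite Euclid_dvdM // negb_or ps. Qed.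

Lemma ndvdp_neq0 s : ~~ (p %| s)%N -> (s%:R : rat) != 0.
Proof. by rewrite pnatr_eq0; apply: contraNneq => ->; rewrite dvdn0. Qed.

Lemma ndvdp1 : ~~ (p %| 1)%N.
Proof. by rewrite dvdn1 neq_ltn prime_gt1 ?orbT. Qed.

Lemma pint_int (m : int) : pint m%:~R.
Proof. by exists 1%N; [exact: ndvdp1 | exists m; rewrite mul1r]. Qed.

Lemma pintD x y : pint x -> pint y -> pint (x + y).
Proof.
move=> [s ps [a Ea]] [t pt [b Eb]]; exists (s * t)%N; first exact: ndvdp_mul.
exists (t%:Z * a + s%:Z * b).
by rewrite natrM rmorphD !rmorphM /= -Ea -Eb -!pmulrn; ring.
Qed.

Lemma pintM x y : pint x -> pint y -> pint (x * y).
Proof.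
move=> [s ps [a Ea]] [t pt [b Eb]]; exists (s * t)%N; first exact: ndvdp_mul.
by exists (a * b); rewrite natrM rmorphM /= -Ea -Eb; ring.
Qed.

Lemma pintN x : pint x -> pint (- x).
Proof.
by move=> [s ps [a Ea]]; exists s => //; exists (- a); rewrite mulrN Ea rmorphN.
Qed.

Lemma pintB x y : pint x -> pint y -> pint (x - y).
Proof. by move=> px /pintN; apply: pintD. Qed.

Lemma pint_sum (I : finType) (F : I -> rat) :
  (forall i, pint (F i)) -> pint (\sum_i F i).
Proof.
move=> pF; elim/big_ind: _ => //; [exact: (pint_int 0) | exact: pintD].
Qed.

Lemma pint_prod (I : finType) (F : I -> rat) :
  (forall i, pint (F i)) -> pint (\prod_i F i).
Proof.
move=> pF; elim/big_ind: _ => //; [exact: (pint_int 1) | exact: pintM].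
Qed.

Lemma pint_det n (A : 'M[rat]_n) : (forall i j, pint (A i j)) -> pint (\det A).
Proof.
move=> pA; apply: pint_sum => s; apply: pintM; last exact: pint_prod.
by rewrite -[-1](rmorphN1 intr) -rmorphXn; apply: pint_int.
Qed.

Lemma pintVn s : ~~ (p %| s)%N -> pint s%:R^-1.
Proof.
by move=> ps; exists s => //; exists 1; rewrite mulfV // ndvdp_neq0.
Qed.

(** The localization of the integers at p is local with maximal ideal
    generated by p: what p does not divide is invertible. *)
Lemma pint_unit q : pint q -> ~ pint (q / p%:R) -> pint q^-1.
Proof.
move=> [s ps [m Em]] npq; have s0 := ndvdp_neq0 ps.
have -> : q = m%:~R / s%:R by rewrite -Em mulrAC mulfV // mul1r.
have p0 : (p%:R : rat) != 0 by rewrite pnatr_eq0 -lt0n prime_gt0.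
have pm : ~~ (p %| `|m|)%N.
  apply/negP=> /dvdnP[k Ek]; apply: npq; exists s => //; exists (sgz m * k%:Z).
  rewrite mulrA Em [m in LHS]intEsg Ek PoszM !rmorphM /= -!pmulrn.
  by field.
rewrite invf_div; apply: pintM; first exact: (pint_int s).
rewrite [m]intEsg rmorphM invfM /=; apply: pintM; last by apply: pintVn.
case: (sgzP m) => _; rewrite ?invr0; [exact: (pint_int 0)|rewrite invr1|].
  exact: (pint_int 1).
by rewrite rmorphN1 invrN1; exact: (pint_int (-1)).
Qed.

Lemma pint_invpN : ~ pint p%:R^-1.
Proof.
move=> [s ps [m Em]]; case/negP: ps.
have p0 : (p%:R : rat) != 0 by rewrite pnatr_eq0 -lt0n prime_gt0.
have : (s%:Z)%:~R = (m * p%:Z)%:~R :> rat.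
  by rewrite rmorphM /= -Em -!pmulrn mulfVK.
by move/intr_inj/(congr1 absz); rewrite abszM /= => ->; rewrite dvdn_mull.
Qed.

Definition padic_val (q : rat) : int :=
  (logn p `|numq q|)%:Z - (logn p `|denq q|)%:Z.

Lemma padic_val_frac (a b : int) : a != 0 -> b != 0 ->
  padic_val (a%:~R / b%:~R) = (logn p `|a|)%:Z - (logn p `|b|)%:Z.
Proof.
move=> a0 b0; set q := _ / _.
have q0 : q != 0 by rewrite mulf_neq0 ?invr_neq0 ?intr_eq0.
have : (numq q * b)%:~R = (a * denq q)%:~R :> rat.
  apply/eqP; rewrite !rmorphM /= -eqr_div ?intr_eq0 ?denq_neq0 //.
  by rewrite divq_num_den.
move/intr_inj/(congr1 (fun z => logn p `|z|)).
rewrite !abszM !lognM ?absz_gt0 ?numq_eq0 ?denq_neq0 //.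
rewrite /padic_val; move: (logn p `|numq q|) (logn p `|denq q|) (logn p `|a|).
by move: (logn p `|b|) => k1 k2 k3 k4; lia.
Qed.

Lemma padic_valM x y :
  x != 0 -> y != 0 -> padic_val (x * y) = padic_val x + padic_val y.
Proof.
move=> x0 y0; rewrite -[x in LHS]divq_num_den -[y in LHS]divq_num_den.
rewrite mulf_div -!rmorphM padic_val_frac ?mulf_neq0 ?numq_eq0 ?denq_neq0 //.
rewrite !abszM !lognM ?absz_gt0 ?numq_eq0 ?denq_neq0 // /padic_val.
move: (logn p `|numq x|) (logn p `|denq x|) (logn p `|numq y|).
by move: (logn p `|denq y|) => k1 k2 k3 k4; lia.
Qed.

Lemma padic_val1 : padic_val 1 = 0.
Proof. by rewrite /padic_val /= logn1. Qed.

Lemma padic_valX x n : x != 0 -> padic_val (x ^+ n) = n%:Z * padic_val x.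
Proof.
move=> x0; elim: n => [|n IH]; first by rewrite padic_val1 mul0r.
rewrite exprS padic_valM ?expf_neq0 // IH; lia.
Qed.

Lemma padic_valV x : x != 0 -> padic_val x^-1 = - padic_val x.
Proof.
move=> x0.
have := padic_valM x0 (invr_neq0 x0); rewrite mulfV // padic_val1; lia.
Qed.

Lemma padic_val_p : padic_val p%:R = 1.
Proof.
have p0 := prime_gt0 p_pr.
have := @padic_val_frac p%:Z 1; rewrite divr1 -pmulrn => -> //; last by lia.
by rewrite /= logn1 logn_prime // eqxx.
Qed.

Lemma pint_val x : x != 0 -> pint x <-> 0 <= padic_val x.
Proof.
move=> x0; split=> [[s ps [m Em]]|].
  have s0 := ndvdp_neq0 ps.
  have m0 : m != 0 by rewrite -(intr_eq0 rat) -Em mulf_neq0.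
  have -> : x = m%:~R / (s%:Z)%:~R by rewrite -Em -pmulrn mulrAC mulfV ?mul1r.
  rewrite padic_val_frac //; last by rewrite -(intr_eq0 rat) -pmulrn.
  by rewrite /= (lognE p s) (negPf ps) !andbF; lia.
rewrite /padic_val subr_ge0 lez_nat => v0.
have den_p : ~~ (p %| `|denq x|)%N.
  apply/negP => pd; have := coprime_num_den x; have := pd.
  rewrite -[p in (p %| _)%N]expn1 pfactor_dvdn ?absz_gt0 ?denq_neq0 // => l1.
  have : (0 < logn p `|numq x|)%N by exact: leq_trans l1 v0.
  rewrite logn_gt0 mem_primes => /and3P[_ _ pn].
  move=> /eqP g1; have : (p %| 1)%N by rewrite -g1 dvdn_gcd pn.
  exact/negP/ndvdp1.
exists `|denq x|%N => //; exists (numq x).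
by rewrite natr_absz ger0_norm ?denq_ge0 // mulrC -numqE.
Qed.

(** The reduction of q modulo p when q is integral at p; elsewhere the value
    is arbitrary.  It separates classes modulo p ([rat_modp_inj]), which is
    how quotients modulo p are seen to be finite. *)
Definition rat_modp (q : rat) : 'F_p := (numq q)%:~R / (denq q)%:~R.

Lemma rat_modp_inj x y : pint x -> pint y -> rat_modp x = rat_modp y ->
  pint ((x - y) / p%:R).
Proof.
have p0 : (p%:R : rat) != 0 by rewrite pnatr_eq0 -lt0n prime_gt0.
have den_p z : pint z -> ~~ (p %| `|denq z|)%N.
  move=> [s ps [m Em]]; apply: contra ps => /dvdn_trans; apply.
  have : (s%:Z * numq z)%:~R = (m * denq z)%:~R :> rat.
    by rewrite !rmorphM /= numqE -Em -pmulrn; ring.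
  move/intr_inj/(congr1 absz); rewrite !abszM /= => E.
  have : (`|denq z| %| s * `|numq z|)%N by rewrite E dvdn_mull.
  by rewrite Gauss_dvdl // coprime_sym coprime_num_den.
have F0 (m : int) : (m%:~R == 0 :> 'F_p) = (p %| `|m|)%N.
  rewrite [m]intEsg rmorphM /= -pmulrn abszM absz_nat.
  case: (sgzP m) => m0; rewrite /= ?mul0r ?mul1r ?mul0n ?dvdn0 ?eqxx ?mul1n //.
    by rewrite (dvdn_pcharf (pchar_Fp p_pr)).
  by rewrite mulN1r oppr_eq0 (dvdn_pcharf (pchar_Fp p_pr)).
move=> px py; have dx := den_p _ px; have dy := den_p _ py.
move/eqP; rewrite eqr_div ?F0 // -!rmorphM -subr_eq0 -rmorphB F0.
move=> /dvdnP[k Ek].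
set m : int := _ - _ in Ek.
have -> : (x - y) / p%:R = m%:~R / p%:R / (denq x)%:~R / (denq y)%:~R.
  rewrite /m !rmorphB !rmorphM /= !numqE; field.
  by rewrite p0 !intr_eq0 !denq_neq0.
have pV (d : int) : ~~ (p %| `|d|)%N -> 0 <= d -> pint d%:~R^-1.
  by move=> pd d0; rewrite -(gez0_abs d0) -pmulrn; apply: pintVn.
apply: pintM; last by apply: pV; rewrite ?denq_ge0.
apply: pintM; last by apply: pV; rewrite ?denq_ge0.
rewrite [m]intEsg Ek PoszM !rmorphM /= -!pmulrn mulrA mulfK //.
by apply: pintM; [exact: pint_int | exact: (pint_int k)].
Qed.
End PAdicRational.

(** * Rational trace, norm and Gram matrices *)

Section TraceNorm.
Variable K : splittingFieldType rat.
Hypothesis galK : galois 1 {:K}.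
Local Notation G := ('Gal({:K} / 1)%g).

Lemma galois_card : #|G| = \dim {:K}.
Proof. by rewrite -(galois_dim galK) dimv1 divn1. Qed.

Lemma rat_algP (x : K) : reflect (exists q : rat, x = q%:A) (x \in 1%VS).
Proof. exact: vlineP. Qed.

Lemma fixed_rat (x : K) : (forall s, s \in G -> s x = x) -> x \in 1%VS.
Proof.
move=> fx; rewrite -[1%VS](galois_fixedField galK).
by apply/fixedFieldP; rewrite ?memvf.
Qed.

Lemma gal_rat (s : gal_of {:K}) (q : rat) : s q%:A = q%:A.
Proof. by rewrite linearZ /= rmorph1. Qed.

Lemma alg_inj : injective (fun q : rat => q%:A : K).
Proof. exact: (fmorph_inj (in_alg K)). Qed.

Definition rat_of (x : K) : rat := xget 0 [set q : rat | x = q%:A]%classic.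

Lemma rat_ofK (x : K) : x \in 1%VS -> (rat_of x)%:A = x.
Proof.
by move=> /rat_algP[q Eq]; rewrite /rat_of; case: xgetP => [y _ <-|/(_ q)].
Qed.

Definition Qtr (x : K) : rat := rat_of (galTrace 1 {:K} x).
Definition Qnorm (x : K) : rat := rat_of (galNorm 1 {:K} x).

Lemma QtrE x : (Qtr x)%:A = galTrace 1 {:K} x.
Proof. by rewrite rat_ofK // mem_galTrace ?memvf. Qed.

Lemma QnormE x : (Qnorm x)%:A = galNorm 1 {:K} x.
Proof. by rewrite rat_ofK // mem_galNorm ?memvf. Qed.

Lemma QtrD x y : Qtr (x + y) = Qtr x + Qtr y.
Proof. by apply: alg_inj; rewrite scalerDl !QtrE raddfD. Qed.

Lemma QtrZ q x : Qtr (q *: x) = q * Qtr x.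
Proof.
apply: alg_inj; rewrite -scalerA !QtrE /galTrace scaler_sumr.
by apply: eq_bigr => s _; rewrite linearZ.
Qed.

Lemma QtrB x y : Qtr (x - y) = Qtr x - Qtr y.
Proof. by rewrite QtrD -scaleN1r QtrZ mulN1r. Qed.

Lemma Qtr_gal s x : s \in G -> Qtr (s x) = Qtr x.
Proof. by move=> Gs; apply: alg_inj; rewrite !QtrE galTrace_gal ?memvf. Qed.

Lemma Qtr_sum (I : finType) (F : I -> K) : Qtr (\sum_i F i) = \sum_i Qtr (F i).
Proof.
by apply: (big_morph Qtr QtrD); rewrite -(scale0r (0 : K)) QtrZ mul0r.
Qed.

Lemma QnormM x y : Qnorm (x * y) = Qnorm x * Qnorm y.
Proof.
by apply: alg_inj; rewrite -scalerA !QnormE galNormM -QnormE mulr_algl -QnormE.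
Qed.

Lemma Qnorm_eq0 x : (Qnorm x == 0) = (x == 0).
Proof.
by rewrite -(inj_eq alg_inj) QnormE scale0r galNorm_eq0.
Qed.

Lemma Qnorm1 : Qnorm 1 = 1.
Proof. by apply: alg_inj; rewrite QnormE galNorm1 scale1r. Qed.

Lemma QnormV x : Qnorm x^-1 = (Qnorm x)^-1.
Proof.
have [->|x0] := eqVneq x 0.
  have E0 : Qnorm 0 = 0 by apply/eqP; rewrite Qnorm_eq0.
  by rewrite invr0 E0 invr0.
apply: (mulfI (x := Qnorm x)); first by rewrite Qnorm_eq0.
by rewrite -QnormM !divff ?Qnorm_eq0 // Qnorm1.
Qed.

Lemma QnormX x k : Qnorm (x ^+ k) = Qnorm x ^+ k.
Proof. by elim: k => [|k IH]; rewrite ?Qnorm1 // !exprS QnormM IH. Qed.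

Lemma Qnorm_rat q : Qnorm q%:A = q ^+ #|G|.
Proof.
apply: alg_inj; rewrite QnormE /galNorm (eq_bigr (fun=> q%:A)).
  by rewrite prodr_const exprZn expr1n.
by move=> s _; rewrite gal_rat.
Qed.

(** Each automorphism s multiplies x by a sign, and s has odd order, so the
    sign is 1. *)
Lemma odd_sqrt_rat (x : K) : odd #|G| -> x ^+ 2 \in 1%VS -> x \in 1%VS.
Proof.
move=> oddG /rat_algP[q Eq]; apply: fixed_rat => s Gs.
have : (s x) ^+ 2 == x ^+ 2 by rewrite -rmorphXn /= Eq gal_rat.
rewrite eqf_sqr => /orP[/eqP // | /eqP sN].
have iter k : (s ^+ k)%g x = (-1) ^+ k * x.
  elim: k => [|k IH]; first by rewrite expg0 gal_id mul1r.
  rewrite expgSr galM ?memvf // IH rmorphM rmorphXn rmorphN1 /= sN exprS.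
  by ring.
have := iter #[s]%g; rewrite expg_order gal_id -signr_odd.
have -> : odd #[s]%g by apply: dvdn_odd oddG; apply: cardSg; rewrite cycle_subG.
by rewrite mulN1r sN => <-.
Qed.

(** The matrix of conjugates: when w is a basis of K, its determinant is a
    square root of the discriminant of w. *)
Definition embmx n (w : 'I_n -> K) : 'M[K]_(#|G|, n) :=
  \matrix_(i, j) (enum_val i : gal_of {:K}) (w j).

Definition gram (mu : K) n (w : 'I_n -> K) : 'M[rat]_n :=
  \matrix_(i, j) Qtr (mu * w i * w j).

Lemma sum_gal (F : gal_of {:K} -> K) :
  \sum_(i < #|G|) F (enum_val i) = \sum_(s in G) F s.
Proof.
by rewrite [RHS]big_enum_val.
Qed.

Lemma gram_embmx mu n (w : 'I_n -> K) :
  map_mx (in_alg K) (gram mu w) =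
  (embmx w)^T *m diag_mx (\row_i (enum_val i : gal_of {:K}) mu) *m embmx w.
Proof.
apply/matrixP => i j; rewrite !mxE /= QtrE /galTrace -sum_gal.
apply: eq_bigr => k _; rewrite mul_mx_diag !mxE !rmorphM /=; ring.
Qed.

Lemma det_gram mu (w : 'I_#|G| -> K) :
  (\det (gram mu w))%:A = galNorm 1 {:K} mu * (\det (embmx w)) ^+ 2.
Proof.
rewrite -[LHS](det_map_mx (in_alg K)) gram_embmx !det_mulmx det_tr det_diag.
rewrite (eq_bigr (fun i => (enum_val i : gal_of {:K}) mu)) => [|i _];
  last by rewrite mxE.
by rewrite /galNorm [in RHS]big_enum_val /=; ring.
Qed.

Lemma det_gram_norm mu (w : 'I_#|G| -> K) :
  \det (gram mu w) = Qnorm mu * \det (gram 1 w).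
Proof.
apply: alg_inj; rewrite -scalerA !det_gram galNorm1 mul1r.
by rewrite -[galNorm _ _ mu]QnormE mulr_algl.
Qed.

(** The discriminant is the square of the determinant of the matrix of
    conjugates, which [odd_sqrt_rat] makes rational. *)
Lemma det_gram_square (w : 'I_#|G| -> K) : odd #|G| ->
  exists d, \det (gram 1 w) = d ^+ 2.
Proof.
move=> oddG; have E := det_gram 1 w; rewrite galNorm1 mul1r in E.
have /(odd_sqrt_rat oddG)/rat_algP[d Ed] : \det (embmx w) ^+ 2 \in 1%VS.
  by apply/rat_algP; eexists; rewrite -E.
by exists d; apply: alg_inj; rewrite E Ed exprZn expr1n.
Qed.

(** Coordinates through the dual basis: solving for the traces against w
    directly gives rational numbers, with no choice of a linear form. *)
Definition coords (w : 'I_#|G| -> K) (x : K) : 'cV[rat]_#|G| :=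
  invmx (gram 1 w) *m \col_j Qtr (x * w j).

(** Multiplying the matrix of conjugates by the coordinates gives the
    conjugates of x; the row of the identity automorphism is the claim. *)
Lemma coordsE (w : 'I_#|G| -> K) x : \det (gram 1 w) != 0 ->
  x = \sum_j coords w x j 0 *: w j.
Proof.
move=> d0.
have uG : gram 1 w \in unitmx by rewrite unitmxE unitfE.
have uS : embmx w \in unitmx.
  rewrite unitmxE unitfE; apply: contraNneq d0 => E.
  by rewrite -(inj_eq alg_inj) det_gram E scale0r expr0n mulr0.
pose c := map_mx (in_alg K) (coords w x).
pose sx : 'cV[K]_#|G| := \col_i (enum_val i : gal_of {:K}) x.
have E : embmx w *m c = sx.
  apply: (@row_full_inj _ _ _ _ (embmx w)^T).
    by rewrite row_full_unit unitmx_tr.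
  have -> : (embmx w)^T *m sx = map_mx (in_alg K) (\col_j Qtr (x * w j)).
    apply/colP => j; rewrite !mxE /= QtrE /galTrace -sum_gal.
    by apply: eq_bigr => k _; rewrite !mxE rmorphM /= mulrC.
  have -> : (embmx w)^T *m (embmx w *m c) = map_mx (in_alg K) (gram 1 w) *m c.
    rewrite mulmxA gram_embmx; congr (_ *m _ *m _).
    rewrite -[LHS]mulmx1; congr (_ *m _); apply/matrixP => i j.
    by rewrite !mxE rmorph1.
  by rewrite /c -map_mxM mulKVmx.
transitivity (sx (enum_rank_in (group1 G) 1%g) 0).
  by rewrite !mxE enum_rankK_in ?group1 // gal_id.
rewrite -E mxE; apply: eq_bigr => j _.
by rewrite [embmx _ _ _]mxE enum_rankK_in ?group1 //
  gal_id [c j 0]mxE mulr_algr.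
Qed.

Lemma det_gram_coords (w w' : 'I_#|G| -> K) (A : 'M[rat]_#|G|) :
  (forall i, w' i = \sum_j A i j *: w j) ->
  \det (gram 1 w') = (\det A) ^+ 2 * \det (gram 1 w).
Proof.
move=> Ew'; have -> : gram 1 w' = A *m gram 1 w *m A^T.
  apply/matrixP => i j; rewrite !mxE !Ew' mul1r.
  rewrite mulr_sumr Qtr_sum; apply: eq_bigr => k _.
  rewrite -scalerAr QtrZ !mxE mulrC; congr (_ * _).
  rewrite mulr_suml Qtr_sum; apply: eq_bigr => l _.
  by rewrite -scalerAl QtrZ !mxE mul1r.
by rewrite !det_mulmx det_tr; ring.
Qed.
End TraceNorm.

(** * Integers and p-local integers *)

Section Integers.
Variable K : fieldExtType rat.
Local Notation OK := (@ring_of_integers K).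

Lemma OK_int (m : int) : OK m%:~R.
Proof. exact: integral_id. Qed.

Lemma OK_nat (m : nat) : OK m%:R.
Proof. exact: (OK_int m). Qed.

Lemma OKD x y : OK x -> OK y -> OK (x + y).
Proof. exact: integral_add. Qed.

Lemma OKM x y : OK x -> OK y -> OK (x * y).
Proof. exact: integral_mul. Qed.

Lemma OKN x : OK x -> OK (- x).
Proof. exact: integral_opp. Qed.

Lemma OKX x k : OK x -> OK (x ^+ k).
Proof.
move=> Ox; elim: k => [|k IH]; first exact: (OK_nat 1).
by rewrite exprS; apply: OKM.
Qed.

Lemma OK_rmorph (f : {rmorphism K -> K}) x : OK x -> OK (f x).
Proof.
move=> [q mon_q qx0]; exists q => //; apply/rootP.
have := congr1 f (rootP qx0); rewrite rmorph0 -horner_map -map_poly_comp.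
by rewrite (eq_map_poly (fun m => rmorph_int f m)).
Qed.

Lemma OK_root (q : {poly K}) x :
  q \is monic -> root q x -> (forall i, OK q`_i) -> OK x.
Proof.
move=> mon_q qx0 Oq; apply: integral_root_monic mon_q qx0 _.
exact/integral_poly.
Qed.

(** The polynomial is transported to the algebraic numbers, where a rational
    number that is an algebraic integer is an integer. *)
Lemma OK_rat q : OK q%:A -> exists m : int, q = m%:~R.
Proof.
move=> [r mon_r rq0]; suff /intrP[m Em] : ratr q \in (Num.int : {pred algC}).
  by exists m; apply: (fmorph_inj (ratr : rat -> algC)); rewrite /= Em ratr_int.
apply: Cint_rat_Aint; first exact: Crat_rat.
have rq : root (map_poly intr r) q.
  rewrite -(fmorph_root (in_alg K)) -map_poly_comp /=.
  by rewrite (eq_map_poly (fun m => rmorph_int (in_alg K) m)).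
apply: (@root_monic_Aint (map_poly intr r)).
- rewrite -(fmorph_root (ratr : rat -> algC)) -map_poly_comp /= in rq.
  by rewrite (eq_map_poly (fun m => rmorph_int ratr m)) in rq.
- exact: monic_map.
by apply/polyOverP => i; rewrite coef_map /= intr_int.
Qed.

Lemma common_denominator (I : finType) (F : I -> K) :
    (forall i, exists2 t : nat, (0 < t)%N & OK (t%:R * F i)) ->
  exists2 t : nat, (0 < t)%N & forall i, OK (t%:R * F i).
Proof.
move=> /fin_all_exists2[t t0 tF]; exists (\prod_i t i)%N => [|i].
  exact: prodn_gt0.
rewrite (bigD1 i) //= mulnC natrM -mulrA; apply: OKM => //; exact: OK_nat.
Qed.

(** Let r be the minimal polynomial of x, of degree d, and let t clear the
    denominators of its coefficients r_i.  Then t x is a root of the monic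
    polynomial with coefficients r_i t^(d-i). *)
Lemma OK_denominator x : exists2 t : nat, (0 < t)%N & OK (t%:R * x).
Proof.
set r := minPoly 1 x; pose d := (size r).-1.
have mon_r : r \is monic by apply: monic_minPoly.
have sz : size r = d.+1 by rewrite prednK // size_poly_gt0 monic_neq0.
have [t t0 tr] : exists2 t : nat, (0 < t)%N &
    forall i : 'I_d.+1, OK (t%:R * r`_i).
  apply: common_denominator => i.
  have /vlineP[q ->] : r`_i \in 1%VS by apply/polyOverP/minPolyOver.
  exists `|denq q|%N; first by rewrite absz_gt0 denq_neq0.
  suff -> : `|denq q|%:R * q%:A = (numq q)%:~R :> K by apply: OK_int.
  have Ed : (denq q)%:~R = `|denq q|%:R :> rat.
    by rewrite natr_absz ger0_norm ?denq_ge0.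
  by rewrite -[RHS](rmorph_int (in_alg K)) numqE Ed rmorphM rmorph_nat mulrC.
exists t => //.
pose q := \poly_(i < d.+1) (r`_i * t%:R ^+ (d - i)).
have q_d : r`_d * t%:R ^+ (d - d) = 1.
  by rewrite subnn mulr1 -[d]/(size r).-1 -lead_coefE (monicP mon_r).
apply: (@OK_root q).
- by rewrite monicE lead_coef_poly ?q_d ?oner_neq0.
- have : r.[x] == 0 by apply: root_minPoly.
  rewrite rootE horner_poly horner_coef sz => /eqP rx.
  apply/eqP; transitivity (t%:R ^+ d * r.[x]);
    last by rewrite horner_coef sz rx mulr0.
  rewrite horner_coef sz mulr_sumr; apply: eq_bigr => i _.
  have -> : (t%:R : K) ^+ d = t%:R ^+ (d - i) * t%:R ^+ i.
    by rewrite -exprD subnK // -ltnS.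
  by rewrite exprMn [r`_i * _]mulrC mulrACA.
move=> i; rewrite coef_poly; case: ifP => [i_d|_]; last exact: (OK_nat 0).
have [->|i_ne] := eqVneq i d; first by rewrite q_d; apply: (OK_nat 1).
have -> : (d - i)%N = (d - i).-1.+1 
  by rewrite prednK // subn_gt0 ltn_neqAle i_ne -ltnS.
rewrite exprS mulrA [r`_i * _]mulrC; apply: OKM.
  exact: (tr (Ordinal i_d)).
by apply: OKX; apply: OK_nat.
Qed.
End Integers.

Section LocalIntegers.
Variables (K : splittingFieldType rat) (p : nat).
Hypothesis p_pr : prime p.
Local Notation OK := (@ring_of_integers K).
Local Notation pp := (ndvdp_mul p_pr).

(** The integral closure in K of the localization of the integers at p,
    written as a ring of fractions of the ring of integers. *)
Definition locint (x : K) : Prop :=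
  exists2 s : nat, ~~ (p %| s)%N & OK (s%:R * x).
Local Notation B := locint.

Lemma p_neq0 : (p%:R : K) != 0.
Proof.
by rewrite -(rmorph_nat (in_alg K)) fmorph_eq0 pnatr_eq0 -lt0n prime_gt0.
Qed.

Lemma locint_int x : OK x -> B x.
Proof. by exists 1%N; [exact: ndvdp1 | rewrite mul1r]. Qed.

Lemma locint_nat k : B k%:R.
Proof. exact/locint_int/OK_nat. Qed.

Lemma locintM x y : B x -> B y -> B (x * y).
Proof.
move=> [s ps Os] [t pt Ot]; exists (s * t)%N; first exact: pp.
by rewrite natrM mulrACA; apply: OKM.
Qed.

Lemma locintD x y : B x -> B y -> B (x + y).
Proof.
move=> [s ps Os] [t pt Ot]; exists (s * t)%N; first exact: pp.
have -> : (s * t)%:R * (x + y) = t%:R * (s%:R * x) + s%:R * (t%:R * y).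
  by rewrite natrM; ring.
by apply: OKD; apply: OKM => //; apply: OK_nat.
Qed.

Lemma locintN x : B x -> B (- x).
Proof. by move=> [s ps Os]; exists s => //; rewrite mulrN; apply: OKN. Qed.

Lemma locintB x y : B x -> B y -> B (x - y).
Proof. by move=> Bx /locintN; apply: locintD. Qed.

Lemma locintX x k : B x -> B (x ^+ k).
Proof.
move=> Bx; elim: k => [|k IH]; first exact: (locint_nat 1).
by rewrite exprS; apply: locintM.
Qed.

Lemma locint_sum (I : finType) (P : pred I) (F : I -> K) :
  (forall i, P i -> B (F i)) -> B (\sum_(i | P i) F i).
Proof.
move=> BF; elim/big_ind: _ => //; [exact: (locint_nat 0) | exact: locintD].
Qed.

Lemma locint_prod (I : finType) (P : pred I) (F : I -> K) :
  (forall i, P i -> B (F i)) -> B (\prod_(i | P i) F i).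
Proof.
move=> BF; elim/big_ind: _ => //; [exact: (locint_nat 1) | exact: locintM].
Qed.

Lemma locint_rmorph (f : {rmorphism K -> K}) x : B x -> B (f x).
Proof.
by move=> [s ps Os]; exists s => //; rewrite -(rmorph_nat f) -rmorphM;
  apply: OK_rmorph.
Qed.

Lemma locint_rat q : B q%:A <-> pint p q.
Proof.
have E s : (s%:R : K) * q%:A = (s%:R * q)%:A.
  by rewrite -(rmorph_nat (in_alg K)) -[q%:A]/(in_alg K q) -rmorphM.
split=> [[s ps]|[s ps [m Em]]].
  by rewrite E => /OK_rat; exists s.
by exists s => //; rewrite E Em -[_%:A]/(in_alg K _) rmorph_int; apply: OK_int.
Qed.

(** If b = t^k - t^l has its denominator cleared by s, then s t is a root of
    the monic polynomial X^l - s^(l-k) X^k + s^(l-1) (s b), all of whose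
    coefficients are integers.  This form of integral closedness is suited to
    finite quotients, where two powers of an element always coincide. *)
Lemma locint_pow_closed k l t : (k < l)%N -> B (t ^+ k - t ^+ l) -> B t.
Proof.
move=> kl [s ps]; set b := _ * _ => Ob; exists s => //.
pose r : {poly K} := s%:R ^+ (l - k) *: 'X^k - (s%:R ^+ l.-1 * b)%:P.
pose q : {poly K} := 'X^l - r.
have szq : (size r < size ('X^l : {poly K}))%N.
  rewrite size_polyXn ltnS; apply: leq_trans (size_polyD _ _) _.
  rewrite size_polyN geq_max (leq_trans (size_scale_leq _ _)) ?size_polyXn //=.
  by rewrite (leq_trans (size_polyC_leq1 _)) //; apply: leq_ltn_trans kl.
have l0 : (0 < l)%N by apply: leq_ltn_trans kl.
apply: (@OK_root _ q).
- by rewrite monicE /q lead_coefDl ?size_polyN // lead_coefXn.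
- rewrite rootE /q /r !hornerE /b; apply/eqP.
  have E1 : (s%:R : K) ^+ l = s%:R ^+ (l - k) * s%:R ^+ k
    by rewrite -exprD subnK // ltnW.
  have E2 : (s%:R : K) ^+ l = s%:R ^+ l.-1 * s%:R by rewrite -exprSr prednK.
  rewrite E1 in E2; rewrite !exprMn E1 /= -E2.
  move: (s%:R ^+ (l - k)) (s%:R ^+ k) (t ^+ l) (t ^+ k) => a c tl tk.
  by ring.
move=> i; rewrite /q /r !coefB coefZ !coefXn coefC.
apply: OKD; first exact: OK_nat.
apply/OKN/OKD.
  by apply: OKM; [apply/OKX/OK_nat | exact: OK_nat].
apply: OKN; case: eqP => _; last exact: (OK_nat K 0).
by apply: OKM => //; apply/OKX/OK_nat.
Qed.
End LocalIntegers.

(** * Bases of the ring of p-local integers *)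

Section IntegralBasis.
Variable K : splittingFieldType rat.
Hypothesis galK : galois 1 {:K}.
Local Notation G := ('Gal({:K} / 1)%g).
Local Notation OK := (@ring_of_integers K).

(** The invertible matrix of conjugates given by the independence of
    automorphisms survives the scaling of its columns that makes them
    integral. *)
Lemma integral_basis_exists : exists w : 'I_#|G| -> K,
  (forall j, OK (w j)) /\ \det (gram 1 w) != 0.
Proof.
have [w _ [uw _ _]] := gal_matrix G.
have [t t0 Ot] := common_denominator (fun j => OK_denominator (tnth w j)).
exists (fun j => t%:R * tnth w j); split=> //.
have tK : (t%:R : K) != 0.
  by rewrite -(rmorph_nat (in_alg K)) fmorph_eq0 pnatr_eq0 -lt0n.
rewrite -(inj_eq (alg_inj (K := K))) scale0r det_gram //
  galNorm1 mul1r expf_eq0 /=.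
have -> : embmx (fun j => t%:R * tnth w j) =
  t%:R *: \matrix_(i, j < #|G|) (enum_val i : gal_of {:K}) (tnth w j).
  by apply/matrixP=> i j; rewrite !mxE rmorphM rmorph_nat.
by rewrite detZ mulf_neq0 ?expf_neq0 // -unitfE -unitmxE.
Qed.
End IntegralBasis.

Section LocalBasis.
Variable K : splittingFieldType rat.
Hypothesis galK : galois 1 {:K}.
Variable p : nat.
Hypothesis p_pr : prime p.
Local Notation G := ('Gal({:K} / 1)%g).
Local Notation B := (@locint K p).

Lemma locint_Qtr x : B x -> pint p (Qtr x).
Proof.
move=> Bx; apply/(@locint_rat K p); rewrite QtrE //.
by apply: locint_sum => // s _; apply: locint_rmorph.
Qed.

Lemma locint_Qnorm x : B x -> pint p (Qnorm x).
Proof.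
move=> Bx; apply/(@locint_rat K p); rewrite QnormE //.
by apply: locint_prod => // s _; apply: locint_rmorph.
Qed.

(** A basis of the ring of p-local integers over the localization of the
    integers at p. *)
Definition local_basis (w : 'I_#|G| -> K) : Prop :=
  [/\ forall j, B (w j), \det (gram 1 w) != 0
    & forall x j, B x -> pint p (coords w x j 0)].

Lemma pint_det_gram mu (w : 'I_#|G| -> K) :
  B mu -> (forall j, B (w j)) -> pint p (\det (gram mu w)).
Proof.
move=> Bmu Bw; apply: pint_det => // i j; rewrite mxE; apply: locint_Qtr.
by do 2!apply: locintM => //.
Qed.

(** Among the bases of K made of p-local integers, one whose discriminant has
    minimal valuation will do.  If some x in B had a coordinate c_j not
    integral at p, then replacing the j-th vector by x would multiply the
    discriminant by c_j^2, which has negative valuation. *)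
Lemma local_basis_exists : exists w, local_basis w.
Proof.
pose P k := exists w : 'I_#|G| -> K,
  [/\ forall j, B (w j), \det (gram 1 w) != 0
    & padic_val p (\det (gram 1 w)) = k%:Z].
have [w0 [Ow0 d0]] := integral_basis_exists galK.
have exP : exists k, `[< P k >].
  exists `|padic_val p (\det (gram 1 w0))|%N; apply/asboolP; exists w0.
  have Bw0 j : B (w0 j) by apply: locint_int.
  split=> //; rewrite gez0_abs //; apply/pint_val => //.
  by apply: pint_det_gram => //; exact: (locint_nat _ p_pr 1).
case: (ex_minnP exP) => k /asboolP[w [Bw dw vk]] kmin.
exists w; split=> // x j Bx; apply/asboolP/negPn/negP => /asboolPn ncj.
set c := coords w x in ncj.
have cj0 : c j 0 != 0.
  by apply/eqP => E; apply: ncj; rewrite E; exact: (pint_int p_pr 0).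
(* Row j of A holds the coordinates of x, the other rows are those of the
   identity, so that det A = c_j. *)
pose w' i := if i == j then x else w i.
pose A : 'M[rat]_#|G| := \matrix_(i, l) if i == j then c l 0 else (i == l)%:R.
have Ew' i : w' i = \sum_l A i l *: w l.
  rewrite /w'; have [->|ij] := eqVneq i j.
    by rewrite {1}(coordsE galK x dw); apply: eq_bigr => l _;
      rewrite [A _ _]mxE eqxx.
  rewrite (bigD1 i) //= [A _ _]mxE (negPf ij) eqxx scale1r big1 ?addr0 //
    => l li.
  by rewrite [A _ _]mxE (negPf ij) eq_sym (negPf li) scale0r.
have dA : \det A = c j 0.
  rewrite (expand_det_col _ j) (bigD1 j) //= big1 ?addr0 => [|i ij].
    rewrite [A _ _]mxE eqxx /cofactor -signr_odd oddD addbb mul1r.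
    suff -> : row' j (col' j A) = 1%:M by rewrite det1 mulr1.
    apply/matrixP => a b; rewrite !mxE eq_sym (negPf (neq_lift _ _)).
    by rewrite (inj_eq lift_inj).
  by rewrite [A _ _]mxE (negPf ij) mul0r.
have dw' := det_gram_coords galK Ew'; rewrite dA in dw'.
have d'0 : \det (gram 1 w') != 0 by rewrite dw' mulf_neq0 ?expf_neq0.
have Bw' i : B (w' i) by rewrite /w'; case: eqP.
have v' : 0 <= padic_val p (\det (gram 1 w')).
  by apply/pint_val => //; apply: pint_det_gram => //;
    exact: (locint_nat _ p_pr 1).
have vc : padic_val p (c j 0) < 0.
  by rewrite ltNge; apply/negP => v0; apply: ncj; apply/pint_val.
have : (k <= `|padic_val p (\det (gram 1 w'))|)%N.
  by apply: kmin; apply/asboolP; exists w'; split=> //; rewrite gez0_abs.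
rewrite -lez_nat gez0_abs // dw' padic_valM ?expf_neq0 // padic_valX // vk.
by move: (padic_val p _) vc => v; lia.
Qed.

Lemma local_basis_div w x : local_basis w ->
  (forall j, pint p (coords w x j 0)) -> B x.
Proof.
move=> [Bw dw _] cx; rewrite (coordsE galK x dw); apply: locint_sum => // j _.
rewrite -mulr_algl; apply: locintM => //.
by apply/locint_rat.
Qed.

Lemma coordsB (w : 'I_#|G| -> K) x y :
  coords w (x - y) = coords w x - coords w y.
Proof.
rewrite /coords -mulmxBr; congr (_ *m _); apply/colP=> j; rewrite !mxE.
by rewrite mulrBl QtrB.
Qed.

Lemma coordsZ (w : 'I_#|G| -> K) q x : coords w (q *: x) = q *: coords w x.
Proof.
rewrite /coords scalemxAr; congr (_ *m _); apply/colP=> j; rewrite !mxE.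
by rewrite -scalerAl QtrZ.
Qed.

(** Finiteness of B/p, stated as the existence of a map to a finite type that
    separates classes; this avoids building the quotient ring. *)
Lemma finite_quotient : exists (T : finType) (red : K -> T),
  forall x y, B x -> B y -> red x = red y -> B ((x - y) / p%:R).
Proof.
have [w bw] := local_basis_exists; have [Bw dw cw] := bw.
exists 'cV['F_p]_#|G|, (fun x => \col_j rat_modp p (coords w x j 0)).
move=> x y Bx By /colP Exy; apply: (local_basis_div bw) => j.
have -> : (x - y) / p%:R = p%:R^-1 *: (x - y).
  by rewrite -mulr_algl -[_%:A]/(in_alg K _) fmorphV rmorph_nat mulrC.
rewrite coordsZ coordsB [X in pint _ X]mxE [X in _ * X]mxE [X in _ + X]mxE.
rewrite mulrC; apply: rat_modp_inj => //; try exact: cw.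
by have := Exy j; rewrite [LHS]mxE [RHS]mxE.
Qed.
End LocalBasis.

(** * The radical of the ring of p-local integers *)

Lemma pigeonhole (T : finType) (f : nat -> T) :
  exists k l, (k < l)%N /\ f k = f l.
Proof.
pose g (i : 'I_#|T|.+1) := f i.
have /injectivePn[i [j ij gij]] : ~~ injectiveb g.
  by apply/injectiveP => /leq_card; rewrite card_ord ltnn.
wlog lt_ij : i j ij gij / (i < j)%N => [wl|]; last by exists i, j.
by move: (ij); rewrite neq_ltn => /orP[/wl|/wl]; apply; rewrite // eq_sym.
Qed.

Section Radical.
Variable K : splittingFieldType rat.
Hypothesis galK : galois 1 {:K}.
Variable p : nat.
Hypothesis p_pr : prime p.
Local Notation G := ('Gal({:K} / 1)%g).
Local Notation B := (@locint K p).

Let B0 : B 0. Proof. exact: (locint_nat K p_pr 0). Qed.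
Let B1 : B 1. Proof. exact: (locint_nat K p_pr 1). Qed.
Let p0 : (p%:R : K) != 0. Proof. exact: p_neq0. Qed.

Lemma locint_gal (s : gal_of {:K}) x : B x -> B (s x).
Proof. exact: locint_rmorph. Qed.

Lemma galVK (s : gal_of {:K}) x : s ((s^-1)%g x) = x.
Proof. by rewrite -galM ?memvf // mulVg gal_id. Qed.

Definition locunit (u : K) : Prop := [/\ u != 0, B u & B u^-1].

Lemma locunit_factor u v : locunit (u * v) -> B u -> B v -> locunit u.
Proof.
move=> [uv0 _ BuvV] Bu Bv.
move: (uv0); rewrite mulf_eq0 negb_or => /andP[u0 v0].
split=> //; have -> : u^-1 = v * (u * v)^-1.
  by rewrite invfM mulrCA mulfV // mulr1.
exact: locintM.
Qed.

(** The inverse of u is the product of its other conjugates divided by the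
    norm of u, so a norm prime to p is enough. *)
Lemma locunit_norm u : B u -> ~ pint p (Qnorm u / p%:R) -> locunit u.
Proof.
move=> Bu nN; have pN : pint p (Qnorm u)^-1.
  by apply: pint_unit => //; apply: locint_Qnorm.
have N0 : Qnorm u != 0.
  by apply: contra_notN nN => /eqP->; rewrite mul0r; exact: (pint_int p_pr 0).
have u0 : u != 0 by rewrite -Qnorm_eq0.
split=> //.
have -> : u^-1 = (Qnorm u)^-1%:A * \prod_(s in G | s != 1%g) s u.
  apply: (mulfI u0); rewrite mulfV //.
  have NA : (Qnorm u)%:A != 0 :> K
    by rewrite -(scale0r 1) (inj_eq (@alg_inj K)).
  rewrite mulrCA; have : u * \prod_(s in G | s != 1%g) s u = (Qnorm u)%:A.
    by rewrite QnormE // /galNorm [RHS](bigD1 1%g) ?group1 //= gal_id.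
  by move=> ->; rewrite -[_^-1%:A]/(in_alg K _) fmorphV mulVf.
apply: locintM => //; first exact/locint_rat.
by apply: locint_prod => // s _; apply: locint_gal.
Qed.

(** The Jacobson radical, through its elementwise characterization, which does
    not mention maximal ideals. *)
Definition rad (x : K) : Prop := B x /\ forall y, B y -> locunit (1 - x * y).

Lemma rad_locint x : rad x -> B x. Proof. by case. Qed.

Lemma radM x y : rad x -> B y -> rad (x * y).
Proof.
move=> [Bx Ux] By; split; first exact: locintM.
by move=> z Bz; rewrite -mulrA; apply: Ux; apply: locintM.
Qed.

Lemma radMl x y : B x -> rad y -> rad (x * y).
Proof. by move=> Bx ry; rewrite mulrC; apply: radM. Qed.

Lemma rad_unit x : rad x -> locunit (1 - x).
Proof. by move=> [_ Ux]; rewrite -(mulr1 x); apply: Ux. Qed.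

Lemma radD x y : rad x -> rad y -> rad (x + y).
Proof.
move=> rx ry; have [Bx Ux] := rx; have [By Uy] := ry.
split=> [|z Bz]; first exact: locintD.
have [u0 Bu BuV] := Ux z Bz.
have Bt : B (1 - (x + y) * z).
  by apply: locintB => //; apply: locintM => //; apply: locintD.
have [v0 Bv BvV] := Uy (z * (1 - x * z)^-1) (locintM p_pr Bz BuV).
(* Factor out the unit 1 - xz and apply the hypothesis on y to z (1 - xz)^-1. *)
have E : 1 - (x + y) * z = (1 - x * z) * (1 - y * (z * (1 - x * z)^-1)).
  by rewrite mulrBr mulr1 (mulrCA _ y) (mulrCA _ z) mulfV //
    mulr1 mulrDl opprD addrA.
split=> //; first by rewrite E mulf_neq0.
by rewrite E invfM; apply: locintM.
Qed.

Lemma radN x : rad x -> rad (- x).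
Proof. by move=> rx; rewrite -mulN1r; apply: radMl => //; apply: locintN. Qed.

Lemma radB x y : rad x -> rad y -> rad (x - y).
Proof. by move=> rx /radN; apply: radD. Qed.

Lemma rad_nonunit u : rad u -> ~ locunit u.
Proof.
by move=> [_ Ru] [u0 _ BV]; case: (Ru _ BV); rewrite mulfV // subrr eqxx.
Qed.

Lemma rad_gal (s : gal_of {:K}) x : rad x -> rad (s x).
Proof.
move=> [Bx Ux]; split=> [|y By]; first exact: locint_gal.
have [u0 Bu BV] := Ux _ (locint_gal (s^-1)%g By).
have -> : 1 - s x * y = s (1 - x * (s^-1)%g y).
  by rewrite rmorphB rmorph1 rmorphM /= galVK.
by split; rewrite ?fmorph_eq0 -?fmorphV //; apply: locint_gal.
Qed.

(** 1 - (xy)^k is a multiple of 1 - xy. *)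
Lemma rad_root x k : B x -> rad (x ^+ k) -> rad x.
Proof.
move=> Bx rx; split=> // y By.
have Bxy : B (x * y) by apply: locintM.
have : locunit (1 - (x * y) ^+ k).
  by rewrite exprMn; apply: rad_unit; apply: radM => //; apply: locintX.
rewrite -opprB subrX1 -mulNr opprB => /locunit_factor; apply.
  exact: locintB.
by apply: locint_sum => // i _; apply: locintX.
Qed.

(** J plays the role of an ideal: a product of elements congruent to 1 modulo
    J is congruent to 1 modulo J. *)
Lemma ideal_prod1B (J : K -> Prop) (I : finType) (P : pred I) (a : I -> K) :
    J 0 -> (forall x y, J x -> J y -> J (x + y)) ->
    (forall x y, B x -> J y -> J (x * y)) -> (forall x, J x -> B x) ->
  (forall i, P i -> J (a i)) -> J (\prod_(i | P i) (1 - a i) - 1).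
Proof.
move=> J0 JD JM JB Ja.
suff [] : J (\prod_(i | P i) (1 - a i) - 1) /\ B (\prod_(i | P i) (1 - a i))
  by [].
elim/big_rec: _ => [|i x Pi [Jx Bx]]; first by rewrite subrr.
have Ji := Ja i Pi; split; last first.
  by apply: locintM => //; apply: locintB => //; apply: JB.
rewrite mulrBl mul1r addrAC; apply: JD => //.
by rewrite mulrC -mulrN -mulN1r; apply: (JM) => //; apply: JM => //;
  apply: locintN.
Qed.

Lemma Qnorm_prod x : (Qnorm x)%:A = \prod_(s in G) s x.
Proof. exact: QnormE. Qed.

Lemma alg_nat k : k%:R%:A = k%:R :> K.
Proof. exact: (rmorph_nat (in_alg K)). Qed.

(** 1 - pr has residue 1 modulo p. *)
Lemma pint_unit_1B r : pint p r -> locunit (1 - p%:R * r)%:A.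
Proof.
move=> pr; set q := 1 - _.
have pQ : (p%:R : rat) != 0 by rewrite pnatr_eq0 -lt0n prime_gt0.
have pq : pint p q.
  by apply: pintB => //; [exact: (pint_int p_pr 1) | apply: pintM => //;
    exact: (pint_int p_pr p)].
have npq : ~ pint p (q / p%:R).
  rewrite mulrBl mul1r mulrAC mulfV // mul1r => /(fun h => pintD p_pr h pr).
  by rewrite subrK; apply: pint_invpN.
split; last 1 first.
- by rewrite -[_%:A]/(in_alg K _) -fmorphV; apply/locint_rat; apply: pint_unit.
- rewrite -[_%:A]/(in_alg K _) fmorph_eq0; apply: contra_notN npq => /eqP->.
  by rewrite mul0r; exact: (pint_int p_pr 0).
by apply/locint_rat.
Qed.

(** The norm of 1 - py is congruent to 1 modulo p, hence prime to p. *)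
Lemma rad_p : rad p%:R.
Proof.
split=> [|y By]; first exact: locint_nat.
apply: locunit_norm; first by apply: locintB => //; apply: locintM => //;
  apply: locint_nat.
pose J x := B (x / p%:R).
have : J ((Qnorm (1 - p%:R * y))%:A - 1).
  rewrite Qnorm_prod.
  under eq_bigr do rewrite rmorphB rmorphM rmorph1 rmorph_nat.
  apply: ideal_prod1B; rewrite /J.
  - by rewrite mul0r.
  - by move=> u v Ju Jv; rewrite mulrDl; apply: locintD.
  - by move=> u v Bu Jv; rewrite -mulrA; apply: locintM.
  - by move=> u Ju; rewrite -(divfK p0 u); apply: locintM => //;
    apply: locint_nat.
  by move=> s _; rewrite mulrAC mulfV // mul1r; apply: locint_gal.
rewrite /J => H1 H2; apply: (pint_invpN p_pr); apply/(@locint_rat K p).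
have -> : p%:R^-1%:A = (Qnorm (1 - p%:R * y) / p%:R)%:A
    - ((Qnorm (1 - p%:R * y))%:A - 1) / p%:R :> K.
  have E q : (q / p%:R)%:A = q%:A / p%:R :> K.
    by rewrite -[_%:A]/(in_alg K _) rmorphM fmorphV rmorph_nat.
  by rewrite E mulrBl opprB addrCA subrr addr0 -[p%:R^-1 in LHS]mul1r E scale1r.
by apply: locintB => //; apply/locint_rat.
Qed.

(** Stability is under the Galois group; in a nonzero stable ideal all primes
    above p occur with the same exponent. *)
Definition stable_ideal (J : K -> Prop) : Prop :=
  [/\ forall x, J x -> B x, J 0, forall x y, J x -> J y -> J (x + y),
      forall x y, B x -> J y -> J (x * y)
    & forall (s : gal_of {:K}) x, s \in G -> J x -> J (s x)].

(** This replaces the transitivity of the Galois group on the primes above p.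
    If 1 - xy is not a unit, its norm is divisible by p.  Since x y and its
    conjugates are in J, this norm is also congruent to 1 modulo J, so J
    contains a rational number of the form 1 - pr, which is a unit. *)
Lemma stable_ideal_full J x : stable_ideal J -> J x -> ~ rad x -> J 1.
Proof.
move=> [JB J0 JD JM Jgal] Jx nrx; apply/asboolP/negPn/negP => /asboolPn nJ1.
apply: nrx; split=> [|y By]; first exact: JB.
have Jxy : J (x * y) by rewrite mulrC; apply: JM.
have B1x : B (1 - x * y) by apply: locintB => //; apply: JB.
apply: locunit_norm => // pNp; apply: nJ1.
have J1 : J ((Qnorm (1 - x * y))%:A - 1).
  rewrite Qnorm_prod; under eq_bigr do rewrite rmorphB rmorph1.
  by apply: ideal_prod1B => // s Gs; apply: Jgal.
have pQ : (p%:R : rat) != 0 by rewrite pnatr_eq0 -lt0n prime_gt0.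
have [u0 _ BV] := pint_unit_1B pNp.
rewrite -(mulVf u0); apply: (JM) => //.
rewrite mulrC divfK // scalerBl scale1r -opprB -mulN1r; apply: JM => //.
exact: locintN.
Qed.
End Radical.

(** * The radical is principal *)

Section Uniformizer.
Variable K : splittingFieldType rat.
Hypothesis galK : galois 1 {:K}.
Variable p : nat.
Hypothesis p_pr : prime p.
Local Notation G := ('Gal({:K} / 1)%g).
Local Notation B := (@locint K p).
Local Notation rad := (@rad K p).

Let B0 : B 0. Proof. exact: (locint_nat K p_pr 0). Qed.
Let B1 : B 1. Proof. exact: (locint_nat K p_pr 1). Qed.
Let Bp : B p%:R. Proof. exact: locint_nat. Qed.
Let p0 : (p%:R : K) != 0. Proof. exact: p_neq0. Qed.
Let BD := @locintD K p p_pr.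
Let BM := @locintM K p p_pr.
Let BB := @locintB K p p_pr.
Let RM := @radM K p p_pr.
Let RMl := @radMl K p p_pr.
Let RD := @radD K p p_pr.
Let RB := @radB K p p_pr.

(** Modulo p two of the elements p t^k coincide, which gives a monic equation
    for t over B. *)
Lemma locint_bounded_powers t : (forall k, B (p%:R * t ^+ k)) -> B t.
Proof.
move=> Bt; have [T [red redB]] := finite_quotient galK p_pr.
have [k [l [kl Ekl]]] := pigeonhole (fun k => red (p%:R * t ^+ k)).
apply: (locint_pow_closed kl).
by have := redB _ _ (Bt k) (Bt l) Ekl; rewrite -mulrBr mulrAC mulfV // mul1r.
Qed.

Lemma rad_divp x : B (x / p%:R) -> rad x.
Proof. by move=> Bx; rewrite -(divfK p0 x); apply: RMl => //; apply: rad_p. Qed.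

(** In a finite ring the powers of x are eventually periodic; m is a multiple
    of the period beyond the preperiod. *)
Lemma idempotent_power x : B x ->
  exists2 m, (0 < m)%N & rad (x ^+ m * x ^+ m - x ^+ m).
Proof.
move=> Bx; have [T [red redB]] := finite_quotient galK p_pr.
have [k [l [kl Ekl]]] := pigeonhole (fun k => red (x ^+ k)).
have Rk : rad (x ^+ k - x ^+ l).
  by apply: rad_divp; apply: redB Ekl; apply: locintX.
pose t := (l - k)%N; have t0 : (0 < t)%N by rewrite subn_gt0.
have per m j : (k <= m)%N -> rad (x ^+ (m + t * j) - x ^+ m).
  move=> km; elim: j => [|j IH].
    by rewrite muln0 addn0 subrr; apply: rad_divp; rewrite mul0r.
  rewrite -(subrKA (x ^+ (m + t * j))); apply: RD IH.
  (* The difference of consecutive terms is a multiple of x^k - x^l. *)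
  have -> : x ^+ (m + t * j.+1) = x ^+ l * x ^+ (m + t * j - k).
    by rewrite -exprD; congr (_ ^+ _); rewrite /t; nia.
  have -> : x ^+ (m + t * j) = x ^+ k * x ^+ (m + t * j - k).
    by rewrite -exprD; congr (_ ^+ _); nia.
  rewrite -mulrBl -opprB; apply: RM; last exact: locintX.
  by apply: radN.
exists (t * k.+1)%N; first by rewrite muln_gt0 t0.
by rewrite -exprD; apply: per; nia.
Qed.

(** A subgroup of B containing pB is a union of classes modulo p, so it is
    determined by its image in the finite set of classes. *)
Definition ideal_over_p (J : K -> Prop) : Prop :=
  [/\ forall x, J x -> B x, forall x y, J x -> J y -> J (x + y)
    & forall x, B (x / p%:R) -> J x].

(** B/p is finite: take the member of F with the fewest classes modulo p.
    This is used to find minimal ideals and also, applied to the ideals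
    generated by 1 - e with e idempotent, to find a maximal idempotent. *)
Lemma minimal_ideal (F : (K -> Prop) -> Prop) :
    (exists J, F J) -> (forall J, F J -> ideal_over_p J) ->
  exists2 J, F J & forall J', F J' -> (forall x, J' x -> J x) ->
    forall x, J x -> J' x.
Proof.
move=> [J0 FJ0] Fid; have [T [red redB]] := finite_quotient galK p_pr.
pose im (J : K -> Prop) : {set T} :=
  [set v | `[< exists2 x, J x & v = red x >]].
have exN : exists n, `[< exists2 J, F J & #|im J| = n >].
  by exists #|im J0|; apply/asboolP; exists J0.
case: (ex_minnP exN) => n /asboolP[J FJ cJ] nmin.
exists J => // J' FJ' sJ'J x Jx.
have imP I v : reflect (exists2 x, I x & v = red x) (v \in im I).
  by rewrite finset.in_set; apply: asboolP.
have sub : im J' \subset im J.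
  apply/fintype.subsetP => v /imP[y Jy ->].
  by apply/imP; exists y => //; apply: sJ'J.
have eqim : im J' = im J.
  apply/eqP; rewrite eqEcard sub cJ; apply: nmin.
  by apply/asboolP; exists J'.
have /imP[y Jy Exy] : red x \in im J' by rewrite eqim; apply/imP; exists x.
have [JB _ _] := Fid J FJ; have [J'B J'D J'p] := Fid J' FJ'.
rewrite -(subrK y x); apply: J'D => //; apply: J'p.
by apply: redB => //; [apply: JB | apply: J'B].
Qed.

(** The fractional ideal inverse to the radical. *)
Definition rad_dual (t : K) : Prop := forall r, rad r -> B (t * r).

Lemma rad_dual_gal (s : gal_of {:K}) t : rad_dual t -> rad_dual (s t).
Proof.
move=> dt r rr; rewrite -(galVK s r) -rmorphM; apply: locint_gal.
by apply: dt; apply: rad_gal.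
Qed.

(** Let a generate a minimal nonzero ideal of B/p.  For r in the radical, a r
    cannot generate the same ideal: a = a r y modulo p would give a = 0 modulo
    p since 1 - r y is a unit.  So a r is in pB, and a/p is in the inverse of
    the radical without being in B. *)
Lemma rad_dual_nonintegral : exists2 t, rad_dual t & ~ B t.
Proof.
pose J a x := exists y z, [/\ B y, B z & x = a * y + p%:R * z].
pose F (I : K -> Prop) := exists a, [/\ B a, ~ B (a / p%:R) & I = J a].
have [||I [a [Ba na EI]] Imin] := @minimal_ideal F.
- exists (J 1), 1; split=> // h; apply: (pint_invpN p_pr).
  apply/(@locint_rat K p); rewrite mul1r in h.
  by rewrite -[_%:A]/(in_alg K _) fmorphV rmorph_nat.
- move=> I [a [Ba _ ->]]; split.
  + by move=> x [y [z [By Bz ->]]]; apply: BD; apply: BM.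
  + move=> x x' [y [z [By Bz ->]]] [y' [z' [By' Bz' ->]]].
    exists (y + y'), (z + z'); split; try exact: BD.
    by rewrite !mulrDr addrACA.
  by move=> x Bx; exists 0, (x / p%:R); split=> //;
    rewrite mulr0 add0r mulrC divfK.
exists (a / p%:R) => // r rr; apply/asboolP/negPn/negP => /asboolPn nar.
have Br := rad_locint rr.
have Far : F (J (a * r)).
  by exists (a * r); split=> //; [apply: BM | rewrite mulrAC].
have sub x : J (a * r) x -> I x.
  move=> [y [z [By Bz ->]]]; rewrite EI; exists (r * y), z; split=> //;
    first exact: BM.
  by rewrite mulrA.
have Ia : I a by rewrite EI; exists 1, 0; split=> //; rewrite mulr1 mulr0 addr0.
have [y [z [By Bz Ea]]] := Imin _ Far sub _ Ia.
have [_ Ur] := rr; have [u0 _ uV] := Ur y By.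
apply: na; have -> : a / p%:R = z * (1 - r * y)^-1.
  apply: (mulIf u0); rewrite mulfVK // mulrAC; apply: (canLR (mulfK p0)).
  by rewrite mulrBr mulr1 {1}Ea mulrA addrAC subrr add0r mulrC.
exact: BM.
Qed.

(** The z for which every product z c d is in the radical form a stable ideal.
    If it were not inside the radical it would contain 1, so the inverse of
    the radical would map the radical to itself and consist of integral
    elements, against [rad_dual_nonintegral]. *)
Lemma rad_invertible z : B z -> ~ rad z ->
  exists c d, [/\ rad c, rad_dual d & ~ rad (z * c * d)].
Proof.
move=> Bz nz; apply/asboolP/negPn/negP => /asboolPn nex.
pose J x := B x /\ forall c d, rad c -> rad_dual d -> rad (x * c * d).
have Jz : J z.
  split=> // c d rc dd; apply/asboolP/negPn/negP => /asboolPn nr.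
  by apply: nex; exists c, d.
have idJ : stable_ideal p J.
  split.
  - by move=> x [].
  - by split=> // c d _ _; rewrite !mul0r; apply: rad_divp; rewrite mul0r.
  - move=> x y [Bx Jx] [By Jy]; split=> [|c d rc dd]; first exact: BD.
    by rewrite !mulrDl; apply: RD; [apply: Jx | apply: Jy].
  - move=> x y Bx [By Jy]; split=> [|c d rc dd]; first exact: BM.
    by rewrite -!mulrA; apply: RMl => //; rewrite mulrA; apply: Jy.
  move=> s x Gs [Bx Jx]; split=> [|c d rc dd]; first exact: locint_gal.
  rewrite -(galVK s c) -(galVK s d) -!rmorphM; apply: rad_gal.
  by apply: Jx; [apply: rad_gal | apply: rad_dual_gal].
have [_ J1] := stable_ideal_full galK p_pr idJ Jz nz.
have [t dt nt] := rad_dual_nonintegral; apply: nt.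
apply: locint_bounded_powers => k; apply: rad_locint.
elim: k => [|k IH]; first by rewrite mulr1; apply: rad_p.
by rewrite exprSr mulrA -[p%:R * _]mul1r; apply: J1.
Qed.

(** In a semilocal ring an invertible ideal is principal.  Consider the
    products e = a b, with a in the radical and b in its inverse, which are
    idempotent modulo the radical, and choose one for which the ideal
    generated by 1 - e is minimal.  If 1 - e is not in the radical,
    [rad_invertible] gives c and d with y = (1 - e) c d outside the radical; a
    power f of y is a nonzero idempotent orthogonal to e, and gluing a with c
    and b with a multiple of d along e replaces e by e + f, a contradiction.
    So e is congruent to 1, hence a unit, and a generates the radical. *)
Theorem uniformizer_exists :
  exists pi, [/\ pi != 0, rad pi & forall r, rad r -> B (r / pi)].
Proof.
have R0 : rad 0 by apply: rad_divp; rewrite mul0r.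
pose J u x := exists z r, [/\ B z, rad r & x = u * z + r].
pose F (I : K -> Prop) := exists a b,
  [/\ rad a, rad_dual b, rad (a * b * (a * b) - a * b) & I = J (1 - a * b)].
have Bab a b : rad a -> rad_dual b -> B (a * b).
  by move=> ra db; rewrite mulrC; apply: db.
have [||I [a [b [ra db re EI]]] Imin] := @minimal_ideal F.
(* The family is not empty: a = b = 0 gives the idempotent 0. *)
- exists (J (1 - 0 * 0)), 0, 0; split=> //; first by move=> r _; rewrite mul0r.
  by rewrite !mul0r subrr.
- move=> I [a [b [ra db _ ->]]]; have Be := Bab a b ra db; split.
  + by move=> x [z [r [Bz [Br _] ->]]]; apply: BD => //; apply: BM => //;
    apply: BB.
  + move=> x y [z [r [Bz rr ->]]] [z' [r' [Bz' rr' ->]]].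
    by exists (z + z'), (r + r'); split;
      [exact: BD|exact: RD|rewrite mulrDr addrACA].
  by move=> x Bx; exists 0, x; split=> //;
    [exact: rad_divp | rewrite mulr0 add0r].
have Be := Bab a b ra db; move De: (a * b) (Be) (re) => e {}Be {}re.
suff r1e : rad (1 - e).
  have := rad_unit p_pr r1e; rewrite opprB addrC subrK -De => -[ab0 _ BV].
  move: (ab0); rewrite mulf_eq0 negb_or => /andP[a0 b0].
  exists a; split=> // r rr; have -> : r / a = b * r * (a * b)^-1.
    by rewrite invfM [b * r]mulrC mulrACA mulfV // mulr1.
  by apply: BM => //; apply: db.
apply/asboolP/negPn/negP => /asboolPn nr1e.
have B1e : B (1 - e) by apply: BB.
have [c [d [rc dd nry]]] := rad_invertible B1e nr1e.
have Bcd := Bab c d rc dd.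
have By : B ((1 - e) * c * d) by rewrite -mulrA; apply: BM.
have [m m0 rfm] := idempotent_power By.
have nrfm : ~ rad (((1 - e) * c * d) ^+ m) by move/(rad_root p_pr By).
have Bg : B (((1 - e) * c * d) ^+ m.-1) by apply: locintX.
have : ((1 - e) * c * d) ^+ m = (1 - e) * c * d * ((1 - e) * c * d) ^+ m.-1.
  by rewrite -exprS prednK.
move: (_ ^+ m) (_ ^+ m.-1) rfm nrfm Bg => f g rf nrf Bg Ef {m m0}.
have Bf : B f by rewrite Ef; apply: BM.
have ref : rad (f * e).
  have -> : f * e = (e * e - e) * - (c * d * g) by rewrite Ef; ring.
  by apply: RM => //; apply: locintN => //; apply: BM.
(* Modulo the radical a' is a where e is 1 and c where e is 0, and likewise
   for b', so a' b' is e + f; the error rho is a multiple of e^2 - e. *)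
pose a' := a * e + (1 - e) * c; pose b' := b * e + (1 - e) * g * d.
have ra' : rad a' by apply: RD; [exact: RM | exact: RMl].
have db' : rad_dual b'.
  move=> r rr; have -> : b' * r = b * r * e + (1 - e) * g * (d * r)
    by rewrite /b'; ring.
  by apply: BD; apply: BM => //; [exact: db | exact: BM | exact: dd].
pose q := b * c + a * d * g.
have Bq : B q by apply: BD; [exact: db | apply: BM => //; exact: Bab].
pose rho := (e * e - e) * (e + 1 + c * d * g - q).
have rrho : rad rho.
  by apply: RM => //; apply: BB => //; apply: BD; [exact: BD | exact: BM].
have Ee' : a' * b' = e + f + rho by rewrite /a' /b' /rho /q Ef -De; ring.
have Brho := rad_locint rrho.
have Fab' : F (J (1 - a' * b')).
  exists a', b'; split=> //; rewrite Ee'.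
  have -> : (e + f + rho) * (e + f + rho) - (e + f + rho) =
    (e * e - e) + (f * f - f)
    + (f * e * 2%:R + rho * (e + f + e + f + rho - 1)) by ring.
  apply: RD; [exact: RD | apply: RD; apply: RM => //].
    exact: locint_nat.
  by apply: BB => //; do !apply: BD => //.
have sub x : J (1 - a' * b') x -> I x.
  move=> [z [r [Bz rr ->]]]; rewrite EI De Ee'.
  exists ((1 - c * d * g) * z), (r - rho * z); split; last by rewrite Ef; ring.
    by apply: BM => //; apply: BB => //; apply: BM.
  by apply: RB => //; apply: RM.
have I1e : I (1 - e) by rewrite EI De; exists 1, 0; split=> //;
  rewrite mulr1 addr0.
have [z [r [Bz rr E1e]]] := Imin _ Fab' sub _ I1e.
(* Multiplying 1 - e = (1 - e') z + r by f, which is orthogonal to e and is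
   killed by 1 - e' modulo the radical, puts f in the radical. *)
apply: nrf; have -> : f = f * e - ((f * f - f) + f * e + f * rho) * z + f * r.
  have -> : f * e - ((f * f - f) + f * e + f * rho) * z + f * r =
    f * e + f * ((1 - (e + f + rho)) * z + r) by ring.
  by rewrite -Ee' -E1e; ring.
apply: RD; last exact: RMl.
apply: RB => //; apply: RM => //; apply: RD; last exact: RMl.
exact: RD.
Qed.
End Uniformizer.

(** * The codifferent is an even power *)

Lemma even_factor (i n k : nat) (v d : int) : odd `|v| ->
  i%:Z * v - n%:Z * ((2 * k)%N%:Z * 1) + 2 * d = 0 -> odd i = false.
Proof.
move=> oddv E; have E' : i%:Z * v = 2 * (n%:Z * k%:Z - d).
  by rewrite -[LHS]subr0 -E PoszM; ring.
have := congr1 (fun z : int => odd `|z|) E'.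
by rewrite !abszM !oddM oddv andbT.
Qed.

Section Codifferent.
Variable K : splittingFieldType rat.
Hypothesis galK : galois 1 {:K}.
Variable p : nat.
Hypothesis p_pr : prime p.
Local Notation G := ('Gal({:K} / 1)%g).
Local Notation B := (@locint K p).
Local Notation rad := (@rad K p).

Let B0 : B 0. Proof. exact: (locint_nat K p_pr 0). Qed.
Let B1 : B 1. Proof. exact: (locint_nat K p_pr 1). Qed.
Let p0 : (p%:R : K) != 0. Proof. exact: p_neq0. Qed.
Let pQ0 : (p%:R : rat) != 0.
Proof. by rewrite pnatr_eq0 -lt0n prime_gt0. Qed.
Let BD := @locintD K p p_pr.
Let BM := @locintM K p p_pr.

(** Both u and its inverse have a norm of nonnegative valuation. *)
Lemma locunit_val (u : K) : locunit p u -> padic_val p (Qnorm u) = 0.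
Proof.
move=> [u0 Bu BV]; have N0 : Qnorm u != 0 by rewrite Qnorm_eq0.
have /pint_val v1 := locint_Qnorm galK p_pr Bu.
have /pint_val v2 := locint_Qnorm galK p_pr BV.
move: v1 v2; rewrite QnormV // padic_valV ?invr_eq0 //
  => /(_ p_pr N0) v1 /(_ p_pr N0).
rewrite oppr_ge0 => v2; apply/eqP; rewrite eq_le v2; exact: v1.
Qed.

Lemma Qnorm_nat k : @Qnorm K k%:R = k%:R ^+ #|G|.
Proof. by rewrite -alg_nat Qnorm_rat. Qed.

Lemma locint_alg_scale q x : pint p q -> B x -> B (q *: x).
Proof. by move=> pq Bx; rewrite -mulr_algl; apply: BM => //;
  apply/locint_rat. Qed.

(** The dual of B for the trace form, with values in the localization of the
    integers at p. *)
Definition codiff (x : K) : Prop := forall y, B y -> pint p (Qtr (x * y)).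

Lemma locint_codiff x : B x -> codiff x.
Proof. by move=> Bx y By; apply: locint_Qtr => //; apply: BM. Qed.

(** The coordinates of x are obtained from the traces of x w_j, integral at p,
    by the inverse Gram matrix, whose denominator is the discriminant. *)
Lemma codiff_det (w : 'I_#|G| -> K) x : (forall j, B (w j)) ->
  \det (gram 1 w) != 0 -> codiff x -> B (\det (gram 1 w) *: x).
Proof.
move=> Bw d0 cx; rewrite [X in B (_ *: X)](coordsE galK x d0) scaler_sumr.
apply: locint_sum => // j _; rewrite scalerA; apply: locint_alg_scale => //.
have -> : \det (gram 1 w) * coords w x j 0 =
    (\adj (gram 1 w) *m \col_j Qtr (x * w j)) j 0.
  by rewrite /coords /invmx unitmxE unitfE d0 -scalemxAl mxE mulrA mulfV ?mul1r.
rewrite mxE; apply: pint_sum => // k; apply: pintM => //; last first.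
  by rewrite mxE; apply: cx.
rewrite mxE /cofactor; apply: pintM => //.
  by rewrite -[-1](rmorphN1 intr) -rmorphXn; apply: pint_int.
by apply: pint_det => // a b; rewrite !mxE mul1r; apply: locint_Qtr => //;
  apply: BM.
Qed.

Lemma codiff_unramified (w : 'I_#|G| -> K) x : (forall j, B (w j)) ->
  ~ pint p (\det (gram 1 w) / p%:R) -> codiff x <-> B x.
Proof.
move=> Bw nd; split=> [cx|]; last exact: locint_codiff.
have d0 : \det (gram 1 w) != 0.
  by apply: contra_notN nd => /eqP->; rewrite mul0r; exact: (pint_int p_pr 0).
rewrite -(scalerK d0 x); apply: locint_alg_scale; last exact: codiff_det.
by apply: pint_unit => //; apply: pint_det_gram.
Qed.

Lemma gramC mu n (w : 'I_n -> K) i j : gram mu w i j = gram mu w j i.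
Proof. by rewrite !mxE mulrAC. Qed.

Lemma coords_lin (w : 'I_#|G| -> K) (c : 'cV[rat]_#|G|) :
  \det (gram 1 w) != 0 -> coords w (\sum_j c j 0 *: w j) = c.
Proof.
move=> d0; rewrite /coords.
have uG : gram 1 w \in unitmx by rewrite unitmxE unitfE.
apply: (canLR (mulKmx uG)); apply/colP => j; rewrite !mxE mulr_suml Qtr_sum //.
by apply: eq_bigr => k _;
  rewrite -scalerAl QtrZ // mxE mul1r mulrC [w j * _]mulrC.
Qed.

(** The dual of w for the form Tr(mu x y) lies in B, because mu times it lies
    in the dual of B.  So the inverse of the Gram matrix has entries integral
    at p, as the Gram matrix itself, and the determinant is a unit. *)
Lemma codiff_unimodular mu (w : 'I_#|G| -> K) : local_basis p w ->
    (forall x, codiff x <-> B (x / mu)) -> mu != 0 ->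
  padic_val p (\det (gram mu w)) = 0.
Proof.
move=> [Bw dw cw] codE mu0; set M := gram mu w.
have pM i j : pint p (M i j).
  by rewrite mxE; apply: (codE (mu * w i)).2 => //;
    rewrite mulrAC mulfV // mul1r.
have dM : \det M != 0 by rewrite det_gram_norm // mulf_neq0 // Qnorm_eq0.
have uM : M \in unitmx by rewrite unitmxE unitfE.
have pV i j : pint p (invmx M i j).
  pose x := \sum_l (col j (invmx M)) l 0 *: w l.
  have Tx k : Qtr (mu * x * w k) = (k == j)%:R.
    have := congr1 (fun A : 'M_ _ => A k j) (mulmxV uM);
      rewrite mxE [RHS]mxE => <-.
    rewrite /x mulr_sumr mulr_suml Qtr_sum //; apply: eq_bigr => l _.
    by rewrite -scalerAr -scalerAl QtrZ //
      [col _ _ _ _]mxE gramC [in RHS]mxE mulrC.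
  have cx : codiff (mu * x).
    move=> y By; rewrite (coordsE galK y dw) mulr_sumr Qtr_sum //.
    apply: pint_sum => // k; rewrite -scalerAr QtrZ // Tx; apply: pintM => //.
      exact: cw.
    exact: (pint_int p_pr (k == j)).
  have Bx : B x by have := (codE _).1 cx; rewrite mulrAC mulfV // mul1r.
  by have := cw x i Bx; rewrite /x coords_lin // mxE.
have v1 : 0 <= padic_val p (\det M) by apply/pint_val => //; apply: pint_det.
have v2 : 0 <= padic_val p (\det (invmx M)).
  by apply/pint_val => //; [rewrite det_inv invr_eq0 | apply: pint_det].
move: v2; rewrite det_inv padic_valV // oppr_ge0 => v2.
by apply/eqP; rewrite eq_le v2.
Qed.

Section WithUniformizer.
Variable pi : K.
Hypotheses (pi0 : pi != 0) (rpi : rad pi).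
Hypothesis pi_div : forall r, rad r -> B (r / pi).

Lemma uniformizer_val : 0 < padic_val p (Qnorm pi).
Proof.
have N0 : Qnorm pi != 0 by rewrite Qnorm_eq0.
have : pint p (Qnorm pi / p%:R).
  apply/asboolP/negPn/negP => /asboolPn nN.
  by apply: (rad_nonunit rpi); apply: locunit_norm => //; apply: rad_locint rpi.
move/(pint_val p_pr); rewrite mulf_neq0 ?invr_eq0 // => /(_ isT).
by rewrite padic_valM ?invr_eq0 // padic_valV // padic_val_p // subr_ge0;
  apply: lt_le_trans.
Qed.

(** Divide L by the largest power of pi that leaves it inside B; this power
    exists since the norm of x0 has finite valuation.  The quotient is again
    stable, pi being equal to its conjugates up to units, and it is not inside
    the radical, so it is B by [stable_ideal_full]. *)
Lemma stable_ideal_power (L : K -> Prop) x0 :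
    stable_ideal p L -> L x0 -> x0 != 0 ->
  exists i, forall x, L x <-> B (x / pi ^+ i).
Proof.
move=> idL Lx0 x00; have [LB L0 LD LM Lgal] := idL.
pose P i := `[< forall x, L x -> B (x / pi ^+ i) >].
have P0 : exists i, P i.
  by exists 0%N; apply/asboolP => x Lx; rewrite expr0 divr1; apply: LB.
have Pbound i : P i -> (i <= `|padic_val p (Qnorm x0)|)%N.
  move=> /asboolP Pi; have := locint_Qnorm galK p_pr (Pi _ Lx0).
  have N0 : Qnorm x0 != 0 by rewrite Qnorm_eq0.
  have Npi0 : Qnorm pi != 0 by rewrite Qnorm_eq0.
  rewrite QnormM // QnormV // QnormX // => /(pint_val p_pr).
  rewrite mulf_neq0 ?invr_eq0 ?expf_neq0 // => /(_ isT).
  rewrite padic_valM ?invr_eq0 ?expf_neq0 // padic_valV ?expf_neq0 //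
    padic_valX //.
  by have := uniformizer_val; move: (padic_val _ _) (padic_val _ _) => v1 v2;
    nia.
case: (ex_maxnP P0 Pbound) => i /asboolP Pi imax; exists i => x.
split=> [|Bx]; first exact: Pi.
have pii0 : pi ^+ i != 0 by rewrite expf_neq0.
suff Lpi : L (pi ^+ i) by rewrite -(divfK pii0 x); apply: LM.
pose L' y := L (pi ^+ i * y).
have idL' : stable_ideal p L'.
  split.
  - by move=> y /Pi; rewrite mulrAC mulfV // mul1r.
  - by rewrite /L' mulr0.
  - by move=> y z Ly Lz; rewrite /L' mulrDr; apply: LD.
  - by move=> y z By Lz; rewrite /L' mulrCA; apply: LM.
  move=> s y Gs Ly; rewrite /L'.
  have spi0 : s pi != 0 by rewrite fmorph_eq0.
  have -> : pi ^+ i * s y = (pi / s pi) ^+ i * s (pi ^+ i * y).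
    by rewrite rmorphM rmorphXn mulrA -exprMn divfK.
  apply: LM; last exact: Lgal.
  apply: locintX => //; rewrite -{1}(galVK s pi) -fmorphV -rmorphM;
    apply: locint_gal.
  by apply: pi_div; apply: rad_gal.
(* Otherwise pi^(i+1) would also divide L, against the choice of i. *)
have [y [Ly ny]] : exists y, L' y /\ ~ rad y.
  apply/asboolP/negPn/negP => /asboolPn nex.
  suff : (i.+1 <= i)%N by rewrite ltnn.
  apply: imax; apply/asboolP => z Lz; rewrite exprSr invfM mulrA.
  apply: pi_div; apply/asboolP/negPn/negP => /asboolPn nr.
  by apply: nex; exists (z / pi ^+ i); split=> //; rewrite /L' mulrC divfK.
by have := stable_ideal_full galK p_pr idL' Ly ny; rewrite /L' mulr1.
Qed.

(** The ideal pB is pi^e B, so n = v(N p) = e v(N pi), and n is odd. *)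
Lemma uniformizer_odd : odd #|G| -> odd `|padic_val p (Qnorm pi)|.
Proof.
move=> oddG; pose L x := B (x / p%:R).
have [||e Ee] := @stable_ideal_power L p%:R _ _ p0; rewrite /L.
- split.
  + by move=> x Lx; rewrite -(divfK p0 x); apply: BM => //; apply: locint_nat.
  + by rewrite mul0r.
  + by move=> x y Lx Ly; rewrite mulrDl; apply: BD.
  + by move=> x y Bx Ly; rewrite -mulrA; apply: BM.
  by move=> s x Gs Lx; rewrite -(rmorph_nat s) -fmorphV -rmorphM;
    apply: locint_gal.
- by rewrite mulfV.
have pie0 : pi ^+ e != 0 by rewrite expf_neq0.
have u : locunit p (p%:R / pi ^+ e).
  split; first by rewrite mulf_neq0 ?invr_eq0.
    by apply: (Ee p%:R).1; rewrite /L mulfV.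
  by rewrite invf_div; apply: (Ee (pi ^+ e)).2; rewrite mulfV.
have := locunit_val u; rewrite QnormM // QnormV // QnormX // Qnorm_nat.
have N0 : Qnorm pi != 0 by rewrite Qnorm_eq0.
rewrite padic_valM ?invr_eq0 ?expf_neq0 // padic_valV ?expf_neq0 //.
rewrite !padic_valX // padic_val_p // mulr1.
have := uniformizer_val; move: (padic_val _ _) => v v0 /eqP;
  rewrite subr_eq0 => /eqP E.
have : #|G| = (e * `|v|)%N by rewrite -[LHS]/`|#|G|%:Z|%N E abszM.
by move=> En; move: oddG; rewrite En oddM => /andP[].
Qed.

(** Comparing valuations in the unimodularity of Tr(mu x y), with mu = pi^i /
    p^(2k), gives i v(N pi) - 2kn + 2 v(delta) = 0 with delta^2 the
    discriminant; v(N pi) is odd, so i is even. *)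
Lemma codiff_even_power : odd #|G| ->
  exists j k, forall x, codiff x <-> B (x / (pi ^+ j / p%:R ^+ k) ^+ 2).
Proof.
move=> oddG; have [w bw] := local_basis_exists galK p_pr; have [Bw dw cw] := bw.
(* An even exponent is chosen for the denominator p^(2k) of the dual, so that
   only the exponent of pi is in question. *)
set d := \det (gram 1 w) in dw; pose k := `|padic_val p d|%N.
have pk0 : (p%:R ^+ (2 * k) : K) != 0 by rewrite expf_neq0.
have pkQ0 : (p%:R ^+ (2 * k) : rat) != 0 by rewrite expf_neq0.
pose L x := codiff (x / p%:R ^+ (2 * k)).
have LB x : L x -> B x.
  move=> /(codiff_det Bw dw) Bdx.
  have -> : x = (p%:R ^+ (2 * k) / d) *: (d *: (x / p%:R ^+ (2 * k))).
    rewrite scalerA divfK //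
      -mulr_algl -[_%:A]/(in_alg K _) rmorphXn /= alg_nat.
    by rewrite mulrC divfK.
  apply: locint_alg_scale => //; apply/pint_val => //.
    by rewrite mulf_neq0 ?invr_eq0.
  rewrite padic_valM ?invr_eq0 // padic_valV // padic_valX // padic_val_p //
    mulr1.
  by rewrite /k; move: (padic_val _ _) => v; lia.
have idL : stable_ideal p L.
  split=> //.
  - by rewrite /L mul0r; apply: locint_codiff.
  - move=> x y Lx Ly z Bz; rewrite mulrDl mulrDl QtrD //; apply: pintD => //.
      exact: Lx.
    exact: Ly.
  - move=> x y Bx Ly z Bz.
    have -> : x * y / p%:R ^+ (2 * k) * z = y / p%:R ^+ (2 * k) * (x * z).
      by rewrite -!mulrA mulrCA; congr (_ * _); rewrite mulrCA.
    by apply: Ly; apply: BM.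
  move=> s x Gs Lx z Bz;
    rewrite -(galVK s z) -(rmorph_nat s) -rmorphXn -fmorphV -!rmorphM.
  by rewrite Qtr_gal //; apply: Lx; apply: locint_gal.
have L1 : L (p%:R ^+ (2 * k)) by rewrite /L mulfV //; apply: locint_codiff.
have [i Ei] := stable_ideal_power idL L1 pk0.
have codE x : codiff x <-> B (x / (pi ^+ i / p%:R ^+ (2 * k))).
  have := Ei (x * p%:R ^+ (2 * k)); rewrite /L mulfK // => ->.
  by rewrite invf_div mulrA.
have pii0 : pi ^+ i != 0 by rewrite expf_neq0.
have mu0 : pi ^+ i / p%:R ^+ (2 * k) != 0 :> K by rewrite mulf_neq0 ?invr_eq0.
have := codiff_unimodular bw codE mu0; rewrite det_gram_norm // -/d.
have [delta Ed] := det_gram_square galK w oddG; rewrite -/d in Ed.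
have N0 : Qnorm pi != 0 by rewrite Qnorm_eq0.
have delta0 : delta != 0 by apply: contraNneq dw => E; rewrite Ed E expr0n.
have E2 : (p%:R ^+ (2 * k) : rat) ^+ #|G| != 0 by rewrite expf_neq0.
rewrite QnormM // QnormV // !QnormX // Qnorm_nat exprAC.
rewrite padic_valM ?mulf_neq0 ?invr_eq0 ?expf_neq0 //
  padic_valM ?invr_eq0 ?expf_neq0 //.
rewrite padic_valV ?expf_neq0 // !padic_valX ?expf_neq0 // padic_val_p //
  Ed padic_valX //.
have oddv := uniformizer_odd oddG.
have v0 := uniformizer_val.
move: (padic_val _ (Qnorm pi)) (padic_val p delta) oddv v0 => v vd oddv v0 E.
have /negbT := even_factor oddv E.
rewrite -dvdn2 => /dvdnP[j Ej].
exists j, k => x; rewrite codE Ej expr_div_n -!exprM.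
by rewrite (mulnC k).
Qed.
End WithUniformizer.

(** The dual of lambda B is lambda^-1 times the dual lambda^2 B of B. *)
Theorem local_selfdual : odd #|G| -> exists2 lambda : K, lambda != 0 &
  forall x, codiff (lambda * x) <-> B (x / lambda).
Proof.
move=> oddG; have [pi [pi0 rpi pi_div]] := uniformizer_exists galK p_pr.
have [j [k codE]] := codiff_even_power pi0 rpi pi_div oddG.
set l := pi ^+ j / p%:R ^+ k in codE.
have l0 : l != 0 by rewrite mulf_neq0 ?invr_eq0 ?expf_neq0.
exists l => // x; rewrite codE.
by rewrite expr2 invfM mulrA [l * x]mulrC mulfK.
Qed.
End Codifferent.

(** * From self-dual lattices at every prime to a self-dual ideal *)

Section Global.
Variable K : splittingFieldType rat.
Local Notation OK := (@ring_of_integers K).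

(** Take the smallest positive integer t with t x integral.  A prime divisor p
    of t would be avoided by a denominator prime to p, and the gcd of the two
    would be a smaller t. *)
Lemma locint_global x : (forall p, prime p -> @locint K p x) -> OK x.
Proof.
move=> Bx; have [t0 t00 Ot0] := OK_denominator x.
have ex : exists t, (0 < t)%N && `[< OK (t%:R * x) >].
  by exists t0; rewrite t00; apply/asboolP.
case: (ex_minnP ex) => t /andP[tpos /asboolP Ot] tmin.
have [t1|t_neq1] := eqVneq t 1%N; first by rewrite t1 mul1r in Ot.
have t_gt1 : (1 < t)%N by rewrite ltn_neqAle eq_sym t_neq1.
have [s ps Os] := Bx _ (pdiv_prime t_gt1).
have [a _ /dvdnP[k Ek]] := Bezoutl s tpos.
have Og : OK ((gcdn t s)%:R * x).
  have -> : (gcdn t s)%:R * x = k%:R * (t%:R * x) - a%:R * (s%:R * x).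
    by rewrite !mulrA -!natrM -Ek natrD mulrDl addrK.
  by apply: OKD; [|apply: OKN]; apply: OKM => //; apply: OK_nat.
have : (t <= gcdn t s)%N.
  by apply: tmin; rewrite gcdn_gt0 tpos; apply/asboolP.
move=> /(fun h => conj h (dvdn_leq tpos (dvdn_gcdl t s))) [h1 h2].
case/negP: ps; apply: dvdn_trans (pdiv_dvd t) _.
by have -> : t = gcdn t s by [apply/eqP; rewrite eqn_leq h1]; apply: dvdn_gcdr.
Qed.

(** A prime p different from q is a unit at q. *)
Lemma locint_div_prime p q k x : prime p -> prime q -> p != q ->
  @locint K q (p%:R ^+ k * x) -> locint q x.
Proof.
move=> p_pr q_pr pq [s qs Os].
exists (s * p ^ k)%N; last by rewrite natrM natrX -mulrA.
apply: ndvdp_mul => //; rewrite Euclid_dvdX // negb_and.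
by rewrite dvdn_prime2 // eq_sym pq.
Qed.

Hypothesis galK : galois 1 {:K}.
Local Notation G := ('Gal({:K} / 1)%g).
Hypothesis oddG : odd #|G|.

(** The intersection of the local lattices is dual to itself because each
    local lattice is generated, over the localization at p, by the
    intersection: an element of the lattice at p enters all other ones after
    multiplication by an integer prime to p. *)
Theorem unimodular_ideal_exists :
  exists I : set K, fractional_ideal I /\
    forall x, I x <-> forall y, I y -> exists n : int, Qtr (x * y) = n%:~R.
Proof.
have [w [Ow dw]] := integral_basis_exists galK.
set D := \det (gram 1 w) in dw.
have [m Em] : exists m : int, D = m%:~R.
  apply: (@OK_rat K); apply: locint_global => p p_pr; apply/locint_rat.
  apply: pint_det_gram => //; first exact: (locint_nat K p_pr 1).
  by move=> j; apply: locint_int.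
have m0 : m != 0 by rewrite -(intr_eq0 rat) -Em.
pose R p (l : K) := prime p -> [/\ l != 0,
  forall x, codiff p (l * x) <-> locint p (x / l) & ~~ (p %| `|m|)%N -> l = 1].
have /boolp.choice[lam lamP] : forall p, exists l, R p l.
  move=> p; have [p_pr|np] := boolP (prime p); last first.
    by exists 1 => p_pr; rewrite p_pr in np.
  have [pm|pm] := boolP (p %| `|m|)%N.
    by have [l l0 Hl] := local_selfdual galK p_pr oddG; exists l => _; split;
      rewrite ?pm.
  exists 1 => _; split=> // [|x]; first exact: oner_neq0.
  rewrite mul1r divr1; apply: (codiff_unramified galK p_pr (w := w)) => [j|].
    exact: locint_int.
  rewrite -/D Em => -[s ps [a Ea]]; case/negP: pm.
  have p0 : (p%:R : rat) != 0 by rewrite pnatr_eq0 -lt0n prime_gt0.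
  have : (s%:Z * m)%:~R = (a * p%:Z)%:~R :> rat.
    by rewrite !rmorphM /= -Ea -!pmulrn mulrA divfK.
  move/intr_inj/(congr1 absz); rewrite !abszM /= => E.
  have : (p %| s * `|m|)%N by rewrite E dvdn_mull.
  by rewrite Euclid_dvdM // (negPf ps).
have lam0 p : prime p -> lam p != 0 by case/lamP.
have lamD p x : prime p -> codiff p (lam p * x) <-> locint p (x / lam p).
  by case/lamP.
(* A common denominator c of the inverses of all the lambdas: those at primes
   beyond |m| are equal to 1, so finitely many matter. *)
have [c c0 Oc] := common_denominator (fun i : 'I_`|m|.+1 =>
  OK_denominator (lam i)^-1).
have Bc p : prime p -> locint p (c%:R / lam p).
  move=> p_pr; have [_ _ lam1] := lamP p p_pr.
  have [pm|/lam1->] := boolP (p %| `|m|)%N; last by rewrite divr1;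
    apply: locint_nat.
  have pm' : (p < `|m|.+1)%N by rewrite ltnS dvdn_leq // absz_gt0.
  by apply: locint_int; have := Oc (Ordinal pm').
have cK0 : (c%:R : K) != 0.
  by rewrite -alg_nat -(scale0r 1) (inj_eq (@alg_inj K)) pnatr_eq0 -lt0n.
pose I : set K := fun x => forall p, prime p -> locint p (x / lam p).
(* The intersection I and the local lattice at p are dual to each other at p. *)
have trI x y p : prime p -> I x -> locint p (y / lam p) -> pint p (Qtr (x * y)).
  move=> p_pr Ix By; have := (lamD p x p_pr).2 (Ix p p_pr) _ By.
  by rewrite [lam p * x]mulrC -mulrA [lam p * _]mulrC divfK // lam0.
exists I; split.
  split.
  - split=> [p p_pr|x y Ix Iy p p_pr]; first by rewrite mul0r;
    exact: (locint_nat K p_pr 0).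
    by rewrite mulrDl; apply: locintD => //; [apply: Ix | apply: Iy].
  - move=> a x Oa Ix p p_pr; rewrite -mulrA; apply: locintM => //;
    last exact: Ix.
    exact: locint_int.
  - by exists c%:R.
  exists (m%:~R * c%:R); first split.
  + by apply: OKM; [apply: OK_int | apply: OK_nat].
  + by rewrite mulf_neq0 // -(rmorph_int (in_alg K)) fmorph_eq0 intr_eq0.
  move=> x Ix; apply: locint_global => p p_pr.
  (* Since I contains c B locally, duality puts c I inside the dual of B, which
     the discriminant D sends into B. *)
  have -> : m%:~R * c%:R * x = D *: (c%:R * x).
    by rewrite -mulr_algl -mulrA Em -[_%:A]/(in_alg K _) rmorph_int.
  apply: (codiff_det galK p_pr) => // [j|y By]; first exact: locint_int.
  have -> : c%:R * x * y = x * (c%:R * y) by rewrite mulrAC mulrC.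
  apply: (trI _ _ _ p_pr) => //; rewrite mulrAC; apply: locintM => //.
  exact: Bc.
move=> x; split=> [Ix y Iy|dx p p_pr].
  apply: (@OK_rat K); apply: locint_global => p p_pr; apply/locint_rat.
  by apply: trI => //; apply: Iy.
apply/lamD => // y By; set z := lam p * y.
have -> : lam p * x * y = x * z by rewrite /z mulrAC mulrC.
have [t t0 Ot] := OK_denominator z.
(* The parts t' and c' prime to p of t and c are units at p, while the parts
   that are powers of p are units at every other prime. *)
have [t' pt' Et] := pfactor_coprime p_pr t0.
have [c' pc' Ec] := pfactor_coprime p_pr c0.
have pdiv s : coprime p s -> ~~ (p %| s)%N by rewrite prime_coprime.
have Isz : I ((t' * c')%:R * z).
  move=> q q_pr; have [<-|pq] := eqVneq p q.
    have -> : (t' * c')%:R * z / lam p = (t' * c')%:R * y.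
      by rewrite /z -mulrA [lam p * y]mulrC mulfK // lam0.
    by apply: locintM => //; apply: locint_nat.
  have -> : (t' * c')%:R * z / lam q = (t'%:R * z) * (c'%:R / lam q).
    by rewrite natrM -mulrA mulrACA.
  apply: locintM => //.
    apply: (locint_div_prime (k := logn p t) p_pr q_pr pq).
    by rewrite mulrA -natrX -natrM mulnC -Et; apply: locint_int.
  apply: (locint_div_prime (k := logn p c) p_pr q_pr pq).
  by rewrite mulrA -natrX -natrM mulnC -Ec; apply: Bc.
have [n En] := dx _ Isz; exists (t' * c')%N.
  by apply: ndvdp_mul => //; apply: pdiv.
by exists n; rewrite -En -(alg_nat K (t' * c')) mulr_algl -scalerAr QtrZ.
Qed.
End Global.

(** * Square-free levels *)

Lemma CM_field_even (K : splittingFieldType rat) :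
  CM_field K -> ~~ odd (\dim {:K}).
Proof.
move=> [_ [F [dF _]]]; have := divnK (field_dimS (subvf F)).
by rewrite dF mul2n => <-; rewrite odd_double.
Qed.

Lemma cconj_id (K : splittingFieldType rat) (iota : {rmorphism K -> algC}) x :
  totally_real K -> cconj iota x = x.
Proof.
move=> realK; apply: (fmorph_inj iota); rewrite cconjP.
exact: CrealP (realK iota x).
Qed.

(** A rational square root of an integer is an integer, whose square divides
    l. *)
Lemma squarefree_sqrt_rat (K : splittingFieldType rat) (l : nat) (beta : K) :
  squarefree l -> beta \in 1%VS -> l%:R = beta * beta -> l = 1%N.
Proof.
move=> sql /rat_algP[q Eq] El.
have Obeta : ring_of_integers beta.
  apply: (@OK_root K ('X^2 - l%:R%:P)); first exact: monicXnsubC.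
    by rewrite rootE !hornerE El expr2 subrr.
  move=> i; rewrite coefB coefXn coefC; apply: OKD; first exact: OK_nat.
  by apply: OKN; case: eqP => _; [exact: OK_nat | exact: (OK_nat K 0)].
rewrite Eq in Obeta El; have [m Em] := OK_rat Obeta.
have : (l%:Z)%:~R = (m * m)%:~R :> rat.
  apply: (@alg_inj K); rewrite rmorphM /= -Em -pmulrn.
  by rewrite -[LHS](rmorph_nat (in_alg K)) -[RHS](rmorphM (in_alg K)) in El *.
move/intr_inj/(congr1 absz); rewrite abszM /= => Elm.
by have := sql `|m|%N; rewrite Elm -mulnn dvdnn => /(_ isT) ->.
Qed.

Local Open Scope classical_set_scope.

Theorem proposition5p2 (K : splittingFieldType rat)
    (iota : {rmorphism K -> algC})
    (galK : galois 1 {:K}) (oddK : odd (\dim {:K}))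
    (realK_or_CM : totally_real K \/ CM_field K) :
  Mod_set iota = [set 1%N].
Proof.
have realK : totally_real K.
  by case: realK_or_CM => // /CM_field_even; rewrite oddK.
have oddG : odd #|'Gal({:K} / 1)%g| by rewrite galois_card.
apply/seteqP; split=> [l [_ sql [I [alpha [_ [beta [_ _ El]]]]]]|l ->] /=.
  rewrite cconj_id // in El; apply: (squarefree_sqrt_rat sql _ El).
  apply: (odd_sqrt_rat galK oddG); rewrite expr2 -El -alg_nat.
  by apply/rat_algP; exists l%:R.
split=> // [d|].
  by rewrite dvdn1 -mulnn muln_eq1 => /andP[/eqP].
have [I [fracI dualI]] := unimodular_ideal_exists galK oddG.
exists I, 1; split.
  by split=> // [|s _]; rewrite ?oner_neq0 // !rmorph1.
exists 1; split; first exact: oner_neq0; last by rewrite cconj_id ?mulr1.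
have formE x y : lattice_form iota 1 x y = (Qtr (x * y))%:A.
  by rewrite /lattice_form cconj_id // mul1r QtrE.
have algint (n : int) : n%:~R%:A = n%:~R :> K by apply: (rmorph_int (in_alg K)).
have IE x : I x <-> dual_lattice iota I 1 x.
  rewrite dualI; split=> dx y Iy; have [n En] := dx y Iy; exists n.
    by rewrite formE En algint.
  by apply: (@alg_inj K); rewrite -formE En algint.
apply/seteqP; split=> [x Ix|_ [x dx <-]].
  by exists x; [apply/IE | rewrite mul1r].
by rewrite mul1r; apply/IE.
Qed.
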